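(* Let $(X_k)_{k\in\mathbb{Z}}$ be a doubly-infinite stationary semicircular family of random variables, each of law $S(0,1)$, with covariance function $\rho(k)=\varphi(X_0X_k)$, so that $\varphi(X_jX_{k})=\rho(k-j)$ for all $j,k\in\mathbb{Z}$. Suppose there is an integer $n\ge1$ such that $\sum_{k\in\mathbb{Z}}|\rho(k)|^n<\infty$. Then the sequence $$V_m=\frac{1}{\sqrt m}\sum_{k=0}^{m-1}U_n(X_k)$$ converges in law, as $m\to\infty$, to $S(0,\sigma^2)$, where $\sigma^2=\sum_{k\in\mathbb{Z}}\rho(k)^n$.
   Context: $(\mathscr{A},\varphi)$ is a $W^*$-probability space: a von Neumann algebra with a weakly continuous, positive, faithful, unital tracial linear functional $\varphi$. Random variables are self-adjoint elements; the law of $X$ is the unique Borel probability measure $\mu_X$ on $\mathbb{R}$ with $\int t^m\mu_X(dt)=\varphi(X^m)$ for all $m\ge0$; convergence in law is weak convergence of laws. The semicircular law $S(0,t)$, $t>0$, is $\frac{1}{2\pi t}\sqrt{4t-x^2}\,dx$ on $|x|\le2\sqrt t$; $S(0,0)$ is $\delta_0$. A (centred) semicircular family $(X_k)_{k\in\mathbb{Z}}$ is a family of self-adjoint elements with real covariances whose joint moments are $\varphi(X_{k_1}\cdots X_{k_r})=\sum_{\pi\in NC_2(r)}\prod_{\{a,b\}\in\pi,\,a<b}\varphi(X_{k_a}X_{k_b})$, where $NC_2(r)$ is the set of noncrossing pairings of $\{1,\dots,r\}$ (partitions into blocks of size two with no two blocks $\{x_1,y_1\},\{x_2,y_2\}$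 satisfying $x_1<x_2<y_1<y_2$). $U_n$ is the $n$th Chebyshev polynomial of the second kind on $[-2,2]$, defined by $U_n(2\cos\theta)=\sin((n+1)\theta)/\sin\theta$ (the monic orthogonal polynomials of $S(0,1)$). *)

(* Defs.v *)
From HB Require Import structures.
From mathcomp Require Import all_boot all_order all_algebra.
From mathcomp Require Import all_classical all_reals all_analysis.
From mathcomp Require Import measurable_realfun complex ring.

Set Implicit Arguments.
Unset Strict Implicit.
Unset Printing Implicit Defensive.
Import Order.TTheory GRing.Theory Num.Theory.
Import numFieldNormedType.Exports.
Local Open Scope classical_set_scope.
Local Open Scope ring_scope.
Local Open Scope complex_scope.

Section operators.
Variables (R : realType) (H : completeNormedModType R[i]).

(* With the compatibility [inner x x = `|x| ^+ 2] below, a complete normed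
   space carrying a form [ip : {dot H for Num.conj}] is a Hilbert space, the inner
   product being linear in its first argument. *)

Definition bounded_operator (T : H -> H) : Prop := linear T /\ continuous T.

Variable ip : {dot H for Num.conj}.

(* A set of bounded operators is closed in the weak operator topology: T lies
   in M as soon as each basic neighbourhood of T meets M. *)
Definition wot_closed (M : set (H -> H)) : Prop :=
  forall T, bounded_operator T ->
    (forall (N : nat) (x y : 'I_N -> H) (e : R[i]), 0 < e ->
       exists2 S, M S & forall i, `|ip (T (x i) - S (x i)) (y i)| < e) ->
    M T.

Definition square_summable (x : nat -> H) : Prop :=
  cvgn (series (fun k => `|x k| ^+ 2)).

(* The sigma-weak (weak-star) topology on operators is given by the seminorms
   T |-> |sum_k <T x_k, y_k>| with x, y square summable. A linear functional is
   continuous iff it is continuous at 0; seminorms being homogeneous, radius 1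
   is enough. *)
Definition weakly_continuous (A : lmodType R[i]) (rep : A -> H -> H)
    (phi : A -> R[i]) : Prop :=
  forall e : R[i], 0 < e ->
    exists (N : nat) (x y : 'I_N -> nat -> H),
      (forall i, square_summable (x i) /\ square_summable (y i)) /\
      forall a, (forall i, `|limn (series
                   (fun k => ip (rep a (x i k)) (y i k) : R[i]^o))| < 1) ->
        `|phi a| < e.

End operators.

(* A von Neumann algebra with a faithful normal tracial state. The algebra is
   given through an injective unital *-representation [wrep] on a Hilbert space
   whose image is closed in the weak operator topology; the adjoint condition
   determines [star]. *)
Record wstar_prob_space (R : realType) := WStarProbSpace {
  walg :> algType R[i];
  star : walg -> walg;
  whilbert : completeNormedModType R[i];
  inner : {dot whilbert for Num.conj};
  inner_norm : forall x, inner x x = `|x| ^+ 2;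
  wrep : walg -> whilbert -> whilbert;
  wrep_bounded : forall a, bounded_operator (wrep a);
  wrep_inj : injective wrep;
  wrepP : forall (c : R[i]) a b x,
    wrep (c *: a + b) x = c *: wrep a x + wrep b x;
  wrepM : forall a b x, wrep (a * b) x = wrep a (wrep b x);
  wrep1 : forall x, wrep 1 x = x;
  wrep_star : forall a x y, inner (wrep a x) y = inner x (wrep (star a) y);
  wrep_closed : wot_closed inner (range wrep);
  phi : walg -> R[i];
  phi_linear : scalar phi;
  phi_unital : phi 1 = 1;
  phi_trace : forall a b, phi (a * b) = phi (b * a);
  phi_pos : forall a, 0 <= phi (star a * a);
  phi_faithful : forall a, phi (star a * a) = 0 -> a = 0;
  phi_weak : weakly_continuous inner wrep phi
}.

Arguments star {R w} a.
Arguments phi {R w} a.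

Section laws.
Variables (R : realType) (A : wstar_prob_space R).

Definition self_adjoint (a : A) : Prop := star a = a.

Definition is_law (a : A) (mu : {measure set (measurableTypeR R) -> \bar R})
    : Prop :=
  [/\ self_adjoint a, mu setT = 1%E &
   forall m : nat, mu.-integrable setT (fun t => (t ^+ m)%:E) /\
     phi (a ^+ m) = (Rintegral mu setT (fun t => t ^+ m))%:C].

End laws.

Definition weak_cvg (R : realType)
    (mu : nat -> {measure set (measurableTypeR R) -> \bar R})
    (nu : {measure set (measurableTypeR R) -> \bar R}) : Prop :=
  forall f : R -> R, continuous f -> bounded_fun f ->
    Rintegral (mu m) setT f @[m --> \oo] --> Rintegral nu setT f.

(* The law of a self-adjoint element exists and is unique; the sequence of laws
   enters as the (only) sequence [mu] of measures with the required moments. *)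
Definition cvg_in_law (R : realType) (A : wstar_prob_space R) (V : nat -> A)
    (nu : {measure set (measurableTypeR R) -> \bar R}) : Prop :=
  forall mu : nat -> {measure set (measurableTypeR R) -> \bar R},
    (forall m, is_law (V m) (mu m)) -> weak_cvg mu nu.

Section semicircle.
Variables (R : realType) (t : R).

Definition semicircle_pdf (x : R) : R :=
  if `|x| <= 2 * Num.sqrt t
  then (2 * pi * t)^-1 * Num.sqrt (4 * t - x ^+ 2) else 0.

(* Meaningful for 0 <= t only. *)
Definition semicircle (V : set (measurableTypeR R)) : \bar R :=
  if t == 0 then \d_(0 : measurableTypeR R) V
  else (\int[lebesgue_measure]_(x in V) (semicircle_pdf x)%:E)%E.

Lemma semicircle_pdf_ge0 x : 0 <= semicircle_pdf x.
Proof.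
rewrite /semicircle_pdf; case: ifP => // _.
have [t0|t0] := leP 0 t.
  by rewrite mulr_ge0 ?sqrtr_ge0// invr_ge0 !mulr_ge0// pi_ge0.
by rewrite ler0_sqrtr ?mulr0// subr_le0 (le_trans _ (sqr_ge0 x))// pmulr_rle0// ltW.
Qed.

Lemma measurable_semicircle_pdf : measurable_fun setT semicircle_pdf.
Proof.
apply: measurable_fun_ifT => //.
- by apply: measurable_fun_ler => //; exact: measurableT_comp.
- apply: measurable_funM => //.
  apply: (@measurableT_comp _ _ _ _ _ _ (@Num.sqrt R)) => //.
    exact: (continuous_measurable_fun (@sqrt_continuous R)).
  by apply: measurable_funB => //; exact: measurable_funX.
Qed.

Let semicircle0 : semicircle set0 = 0%E.
Proof. by rewrite /semicircle; case: ifP; rewrite ?measure0// integral_set0. Qed.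

Let semicircle_ge0 V : (0 <= semicircle V)%E.
Proof.
rewrite /semicircle; case: ifP => _ //.
by apply: integral_ge0 => x _; rewrite lee_fin semicircle_pdf_ge0.
Qed.

Let semicircle_sigma_additive : semi_sigma_additive semicircle.
Proof.
move=> F mF tF mUF; rewrite /semicircle; case: ifPn => _.
  exact: measure_semi_sigma_additive.
rewrite ge0_integral_bigcup//=; last 2 first.
- apply/measurable_EFinP/measurable_funTS; exact: measurable_semicircle_pdf.
- by move=> x _; rewrite lee_fin semicircle_pdf_ge0.
apply: is_cvg_ereal_nneg_natsum_cond => n _ _.
by apply: integral_ge0 => x _; rewrite lee_fin semicircle_pdf_ge0.
Qed.

HB.instance Definition _ := isMeasure.Build _ _ _
  semicircle semicircle0 semicircle_ge0 semicircle_sigma_additive.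

End semicircle.

Definition noncrossing (r : nat) (P : {set {set 'I_r}}) : bool :=
  [forall x1 : 'I_r, forall y1 : 'I_r, forall x2 : 'I_r, forall y2 : 'I_r,
     ([set x1; y1]%SET \in P) && ([set x2; y2]%SET \in P) ==>
     ~~ [&& (x1 < x2)%N, (x2 < y1)%N & (y1 < y2)%N]].

Definition NC2 (r : nat) : {set {set {set 'I_r}}} :=
  [set P : {set {set 'I_r}} |
     [&& finset.partition P [set: 'I_r]%SET, [forall B in P, #|B| == 2%N] &
         noncrossing P]]%SET.

Definition semicircular_family (R : realType) (A : wstar_prob_space R)
    (I : Type) (X : I -> A) : Prop :=
  [/\ forall i, self_adjoint (X i),
      forall i j, phi (X i * X j) \is Num.real &
      forall (r : nat) (k : 'I_r -> I),
        phi (\prod_(a < r) X (k a)) =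
        \sum_(P in NC2 r)
          \prod_(p : 'I_r * 'I_r | (p.1 < p.2)%N && ([set p.1; p.2]%SET \in P))
            phi (X (k p.1) * X (k p.2))].

Definition is_chebyshevU (R : realType) (n : nat) (U : {poly R}) : Prop :=
  forall theta : R, sin theta != 0 ->
    U.[2 * cos theta] = sin (n.+1%:R * theta) / sin theta.

Lemma is_chebyshevU_ex (R : realType) (n : nat) :
  exists U : {poly R}, is_chebyshevU n U.
Proof.
suff [U [_ [U0 _]]] : exists U V : {poly R},
    is_chebyshevU n U /\ is_chebyshevU n.+1 V by exists U.
elim: n => [|n [U [V [HU HV]]]].
  exists 1, 'X; split=> th s0; first by rewrite hornerC mul1r divff.
  rewrite hornerX (_ : 2%:R * th = th + th); last by ring.
  rewrite sinD; apply: (mulIf s0).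
  by rewrite divfK//; ring.
exists V, ('X * V - U); split=> // th s0.
rewrite hornerD hornerN hornerM hornerX HV// HU//.
apply: (mulIf s0); rewrite mulrBl -mulrA !divfK//.
have -> : n.+3%:R * th = n.+2%:R * th + th by rewrite -[n.+3%:R]natr1; ring.
have -> : n.+1%:R * th = n.+2%:R * th - th by rewrite -[n.+2%:R]natr1; ring.
by rewrite sinB sinD; ring.
Qed.

Lemma is_chebyshevU_uniq (R : realType) (n : nat) (U V : {poly R}) :
  is_chebyshevU n U -> is_chebyshevU n V -> U = V.
Proof.
move=> HU HV; apply/eqP; rewrite -subr_eq0; apply/negP => /negP UV0.
pose c k : R := 2 * cos (k.+1%:R^-1).
have c01 k : (0 < k.+1%:R^-1 :> R) && (k.+1%:R^-1 < pi :> R).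
  rewrite invr_gt0 ltr0n/= (@le_lt_trans _ _ 1)//.
    by rewrite invf_le1 ?ltr0n// ler1n.
  by rewrite (lt_le_trans _ (pi_ge2 R))// ltr1n.
have := max_poly_roots UV0 (_ : all (root (U - V)) (map c (iota 0 (size (U - V))))) _.
rewrite size_map size_iota ltnn => H; apply/notF/H.
  apply/allP => _ /mapP[k _ ->]; rewrite rootE hornerD hornerN.
  by rewrite HU ?HV ?subrr// gt_eqF// sin_gt0_pi.
rewrite map_inj_uniq ?iota_uniq// => i j /mulfI cij.
have /cos_inj : cos (i.+1%:R^-1) = cos (j.+1%:R^-1) :> R by apply: cij; rewrite pnatr_eq0.
have /andP[i0 i1] := c01 i; have /andP[j0 j1] := c01 j.
rewrite !in_itv/= !ltW// => /(_ isT isT)/invr_inj/eqP.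
by rewrite eqr_nat eqSS => /eqP.
Qed.

(* Evaluation of a real polynomial at an element of a complex algebra. *)
Definition real_horner (R : realType) (A : algType R[i]) (p : {poly R})
    (a : A) : A := horner_alg a (map_poly (real_complex R) p).

(* Two-sided series, as the sum of its two one-sided halves
   ([Negz k] is -(k+1)). *)
Definition bilateral_sum (R : realType) (f : int -> R) : R :=
  limn (series (fun k => f (Posz k))) + limn (series (fun k => f (Negz k))).

(* Main.v *)
Require Import Defs.
From mathcomp Require Import all_boot all_order all_algebra.
From mathcomp Require Import all_classical all_reals all_analysis.
From mathcomp Require Import measurable_realfun complex zify ring lra.

Set Implicit Arguments.
Unset Strict Implicit.
Unset Printing Implicit Defensive.
Import Order.TTheory GRing.Theory Num.Theory.
Import numFieldNormedType.Exports.
Local Open Scope classical_set_scope.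
Local Open Scope ring_scope.
Local Open Scope complex_scope.

(** The method of moments reduces the statement to
    [phi (V_m ^ r) -> sigma ^ r * c_r], where [c_r] is the [r]-th moment of
    [S(0,1)]; a limit law with compact support is determined by its moments
    and convergence of moments implies weak convergence ([moments_weak_cvg], by
    polynomial approximation).

    The moments are computed from left to right. In a noncrossing pairing each
    point either opens an arc or closes the last open one
    ([stack_sum_cons]), so the moments of words in the [X_k] are governed by
    the stack of the letters that wait for a partner. In the algebra, this says
    that the Wick words [wick s] satisfy [wick s * X_k = wick (k :: s)] plus one
    contraction, and that [phi (wick s) = 0] unless [s] is empty. As
    [rho 0 = 1], the Chebyshev recursion then gives, for a stack [s] with top
    first,
      [wick s * U_n(X_k)
         = \sum_j (\prod_(x <- take j s) rho (k - x))
                  * wick (k ^ (n - j) ++ drop j s)]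
    ([wick_mul_chebyshev]). Hence [phi (V_m ^ r)] is [m ^ (- r / 2)] times a sum
    over letters [k_1, ..., k_r < m] and numbers of contractions
    [j_1, ..., j_r <= n] of products of covariances, without any condition on
    the family besides its covariance function.

    Let [d ^ (2 n) = 1 / m]. Contracting [j] letters while summing over the new
    letter costs at most [\sum_(|l| < m) |rho l| ^ j], up to a constant; after
    multiplication by [d ^ (2 (n - j))] this is bounded for all [j <= n], and
    tends to [0] for [0 < j < n] because [\sum_l |rho l| ^ n] converges
    ([young_eta], [stationary_moment_cvg]). The powers of [d] exactly use up the
    normalization [m ^ (- r / 2)] ([wick_moment_bound]), so only the terms with
    all [j_i] in [{0, n}] survive in the limit. There the stack consists of
    whole blocks [k ^ n], a step pushes a new block or removes the top one, and
    each removal contributes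
      [1 / m * \sum_(k, l < m) rho (k - l) ^ n -> sigma ^ 2]
    by Cesaro's theorem ([block_moment_step], [cov_mean_cvg]). The limit is the
    number of such push-remove sequences times [sigma ^ r] ([arc_moment]). For
    [n = m = 1] the same formula shows that this number is the moment of the
    law of [X_0], which is [S(0,1)] ([semicircle1_moment]); the moments of
    [S(0, sigma ^ 2)] follow by dilation. Two facts about [S(0,1)] come from
    calculus: its second moment is [1], which gives [rho 0 = 1], and [S(0,t)] is
    its dilation by [sqrt t]. Finally [sigma ^ 2] is the limit of
    [phi (V_m ^ 2)], which is nonnegative since [V_m] is self-adjoint. *)

(** * Noncrossing pairings read from left to right *)

Lemma big_inj_image (T : Type) (idx : T) (op : Monoid.com_law idx)
    (I J : finType) (h : J -> I) (P : pred I) (F : I -> T) :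
  injective h -> (forall i, P i -> exists j, i = h j) ->
  \big[op/idx]_(i | P i) F i = \big[op/idx]_(j | P (h j)) F (h j).
Proof.
move=> hI hS; pose h' i := [pick j | h j == i].
have h'K j : h' (h j) = Some j.
  rewrite /h'; case: pickP => [k /eqP/hI -> //|/(_ j)]; by rewrite eqxx.
rewrite (reindex_omap h h') /=; last by move=> i /hS[j ->]; rewrite h'K.
by apply: eq_bigl => j; rewrite h'K eqxx andbT.
Qed.

Section noncrossing_pairings.
Variables (I : Type) (C : comNzRingType) (c : I -> I -> C).

(** The product of the covariances [c] over the arcs of the pairing [P], the
    point [a] carrying the letter [f a]. *)
Definition pairing_weight (r : nat) (f : nat -> I) (P : {set {set 'I_r}}) : C :=
  \prod_(p : 'I_r * 'I_r | (p.1 < p.2)%N && ([set p.1; p.2]%SET \in P))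
    c (f p.1) (f p.2).

(** No arc of [P] lies inside the first [i] points. In a pairing, this means that
    each of them opens an arc that ends at [i] or later. *)
Definition openers (r i : nat) (P : {set {set 'I_r}}) : bool :=
  [forall x : 'I_r, forall y : 'I_r,
     [&& (x < y)%N, (y < i)%N & [set x; y]%SET \in P] ==> false].

(** The sum of the weights of the noncrossing pairings of [r] points whose first
    [i] points are openers. For [i = 0] it is a joint moment of a semicircular
    family with covariance [c]. *)
Definition open_sum (r i : nat) (f : nat -> I) : C :=
  \sum_(P in NC2 r | openers i P) pairing_weight f P.

Lemma openersP r i (P : {set {set 'I_r}}) :
  reflect (forall x y : 'I_r, (x < y)%N -> (y < i)%N -> [set x; y]%SET \notin P)
          (openers i P).
Proof.
apply: (iffP 'forall_forallP) => H x y.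
  by move=> xy yi; apply/negP => xyP; move: (H x y); rewrite xy yi xyP.
by apply/implyP => /and3P[xy yi xyP]; move: (H x y xy yi); rewrite xyP.
Qed.

(** A set of pairs is a noncrossing pairing when every point lies in a pair,
    its members have two elements, distinct members are disjoint and no two
    members cross. *)
Lemma NC2P r (P : {set {set 'I_r}}) :
  reflect [/\ forall x : 'I_r, exists y : 'I_r, x != y /\ [set x; y]%SET \in P,
              forall B, B \in P -> #|B| = 2,
              forall A B x, A \in P -> B \in P -> x \in A -> x \in B -> A = B &
              forall x1 y1 x2 y2 : 'I_r, [set x1; y1]%SET \in P ->
                [set x2; y2]%SET \in P ->
                ~~ [&& (x1 < x2)%N, (x2 < y1)%N & (y1 < y2)%N]]
          (P \in NC2 r).
Proof.
rewrite finset.inE; apply: (iffP and3P) => [[Pp /forall_inP P2 /forallP nc]|[Pc P2 Pt nc]].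
  split.
  - move=> x; have /and3P[/eqP cov _ _] := Pp.
    have : x \in finset.cover P by rewrite cov finset.inE.
    move=> /finset.bigcupP[B BP xB]; have /eqP/eqP/cards2P[a [b [ab Bab]]] := P2 B BP.
    move: xB; rewrite Bab !finset.inE => /orP[]/eqP->; first by exists b; rewrite -Bab.
    by exists a; rewrite eq_sym ab finset.setUC -Bab.
  - by move=> B /P2/eqP.
  - move=> A B x AP BP xA xB; have /and3P[_ tI _] := Pp.
    apply/eqP; apply/negPn/negP => AB.
    have := finset.trivIsetP tI _ _ AP BP AB.
    by move=> /finset.disjoint_setI0/setP/(_ x); rewrite !finset.inE xA xB.
  - move=> x1 y1 x2 y2 h1 h2.
    move: (nc x1) => /forallP/(_ y1)/forallP/(_ x2)/forallP/(_ y2).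
    by rewrite h1 h2.
split.
- apply/and3P; split.
  + apply/eqP/setP => x; rewrite finset.inE; apply/finset.bigcupP.
    by have [y [_ xyP]] := Pc x; exists [set x; y]%SET => //; rewrite !finset.inE eqxx.
  + apply/finset.trivIsetP => A B AP BP AB; rewrite -finset.setI_eq0; apply/eqP/setP => x.
    rewrite !finset.inE; apply/negP => /andP[xA xB].
    by move/negP: AB; apply; rewrite (Pt _ _ _ AP BP xA xB).
  + by apply/negP => /P2; rewrite cards0.
- by apply/forall_inP => B /P2 ->.
- by apply/forallP => x1; apply/forallP => y1; apply/forallP => x2;
    apply/forallP => y2; apply/implyP => /andP[]; exact: nc.
Qed.

Lemma eq_open_sum r i (f g : nat -> I) :
  (forall a, (a < r)%N -> f a = g a) -> open_sum r i f = open_sum r i g.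
Proof.
move=> fg; apply: eq_bigr => P _; apply: eq_bigr => p _.
by rewrite !fg ?ltn_ord.
Qed.

Lemma open_sum_all r (f : nat -> I) : open_sum r r f = (r == 0)%N%:R.
Proof.
case: r => [|r].
  rewrite /open_sum (big_pred1 finset.set0) => [|P].
    by rewrite /pairing_weight big1// => -[[]].
  apply/andP/eqP => [[/NC2P[_ P2 _ _] _]|->].
    apply/setP => B; rewrite finset.inE; apply/negP => /P2 B2.
    by have := max_card (mem B); rewrite B2 card_ord.
  split; last by apply/openersP => -[].
  by apply/NC2P; split=> [[]//|B|A B x|[]//]; rewrite finset.inE.
rewrite /open_sum big1// => P /andP[/NC2P[Pc _ _ _] /openersP op].
have [y [yx yP]] := Pc ord0.
have y0 : (0 < y)%N by rewrite lt0n; apply: contraNneq yx => y0; apply/eqP/val_inj.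
by have := op ord0 y y0 (ltn_ord y); rewrite yP.
Qed.

(** The point [i] either opens a new arc or is the first one to close an arc; in
    the second case noncrossing forces its partner to be its predecessor. *)
Lemma open_sum_split r i (f : nat -> I) : (i < r)%N ->
  open_sum r i f = open_sum r i.+1 f +
    \sum_(P in NC2 r | openers i P &&
       [exists x : 'I_r, exists y : 'I_r,
          [&& (x.+1 == i)%N, (y == i :> nat)%N & [set x; y]%SET \in P]])
      pairing_weight f P.
Proof.
move=> ir; rewrite /open_sum (bigID (openers i.+1)) /=; congr (_ + _).
  apply: eq_bigl => P; rewrite -andbA; congr andb.
  apply/andb_idl => /openersP op; apply/openersP => x y xy yi.
  by apply: op => //; exact: leqW.
apply: eq_bigl => P; rewrite -andbA.
apply/idP/idP => [/and3P[PN op nop]|/and3P[PN op]].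
  rewrite PN op /=; move: nop; rewrite negb_forall => /existsP[x].
  rewrite negb_forall => /existsP[y]; rewrite implybF negbK => /and3P[xy yi xyP].
  have yE : y = i :> nat.
    apply/eqP; rewrite eqn_leq -ltnS yi /= leqNgt; apply/negP => yi'.
    by move/openersP: op => /(_ x y xy yi'); rewrite xyP.
  have xi : (x < i)%N by rewrite -yE.
  have i0 : (0 < i)%N by case: (i) xi.
  have zr : (i.-1 < r)%N by apply: leq_ltn_trans ir; exact: leq_pred.
  pose z := Ordinal zr; have zi : z.+1 = i by rewrite /= prednK.
  suff xz : x = z.
    apply/existsP; exists z; apply/existsP; exists y.
    by rewrite zi eqxx yE eqxx -xz xyP.
  (* if the partner x of i were not z = i - 1, then the arc opened at z would
     cross the arc from x to i *)
  apply/eqP/negPn/negP => xz.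
  have xz' : (x < z)%N by rewrite ltn_neqAle xz -ltnS zi xi.
  have [Pc _ Pt nc] := NC2P _ PN; have [w [wz zwP]] := Pc z.
  have [wz'|zw|zw] := ltngtP w z; last by case/eqP: wz; apply/val_inj.
    move/openersP: op => /(_ w z wz'); rewrite -zi leqnn => /(_ isT).
    by rewrite finset.setUC zwP.
  have [wy|wy] := eqVneq w y.
    have /setP/(_ z) : [set x; y]%SET = [set z; w]%SET.
      by apply: (Pt _ _ y) => //; rewrite !finset.inE ?wy eqxx ?orbT.
    rewrite !finset.inE eqxx eq_sym (negbTE xz) /= => /eqP zy.
    by move: zi; rewrite zy yE; lia.
  have yw : (y < w)%N by rewrite ltn_neqAle eq_sym wy yE -zi.
  by have := nc _ _ _ _ xyP zwP; rewrite xz' yw yE -zi leqnn.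
move=> /existsP[x /existsP[y /and3P[/eqP xi /eqP yi xyP]]].
rewrite PN op; apply/openersP => /(_ x y).
by rewrite yi -xi !leqnn => /(_ isT isT); rewrite xyP.
Qed.

(** The increasing map of [nat] that omits the values [i] and [i + 1]. *)
Definition skip2 (i a : nat) : nat := if (a < i)%N then a else a.+2.

(** The insertion [ins] of an arc [{i, i + 1}] into a pairing of [r] points is a
    bijection onto the noncrossing pairings of [r + 2] points that contain this
    arc; it multiplies the weight by the covariance of the two new letters. *)
Section insert_adjacent_pair.
Variables (r i : nat) (ir : (i <= r)%N).

Let i0 : 'I_r.+2 := inord i.
Let i1 : 'I_r.+2 := inord i.+1.
Let e : {set 'I_r.+2} := [set i0; i1]%SET.
Let h (a : 'I_r) : 'I_r.+2 := inord (skip2 i a).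

Let i0E : i0 = i :> nat. Proof. by rewrite inordK//; lia. Qed.
Let i1E : i1 = i.+1 :> nat. Proof. by rewrite inordK//; lia. Qed.

Let hE a : h a = skip2 i a :> nat.
Proof. by have ar := ltn_ord a; rewrite inordK// /skip2; case: (ltnP a i); lia. Qed.

Let h_lt a b : (h a < h b)%N = (a < b)%N.
Proof. by rewrite !hE /skip2; case: (ltnP a i); case: (ltnP b i); lia. Qed.

Let h_inj : injective h.
Proof.
move=> a b hab; apply/val_inj => /=.
by have := h_lt a b; have := h_lt b a; rewrite hab ltnn; lia.
Qed.

Let h_lti a : (h a < i.+1)%N = (a < i)%N.
Proof. by rewrite hE /skip2; case: (ltnP a i); lia. Qed.

Let he a : h a \notin e.
Proof.
by rewrite !finset.inE -!val_eqE /= hE i0E i1E /skip2; case: (ltnP a i); lia.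
Qed.

Let hS x : x \notin e -> exists a, x = h a.
Proof.
rewrite !finset.inE -!val_eqE /= i0E i1E negb_or => /andP[xi xi'].
have xr := ltn_ord x; have [xi2|xi2] := ltnP x i.
  have xr' : (x < r)%N by lia.
  by exists (Ordinal xr'); apply/val_inj => /=; rewrite hE /skip2 /= xi2.
have xr' : (x.-2 < r)%N by lia.
exists (Ordinal xr'); apply/val_inj => /=; rewrite hE /skip2 /=.
by case: (ltnP x.-2 i); lia.
Qed.

Let ins (P : {set {set 'I_r}}) : {set {set 'I_r.+2}} :=
  (e |: [set h @: (B : {set 'I_r}) | B in P])%SET.

Let im_e (B : {set 'I_r}) : (h @: B)%SET != e.
Proof.
apply/negP => /eqP/setP/(_ i0); rewrite !finset.inE eqxx /= => /imsetP[a _ a0].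
by have := he a; rewrite -a0 !finset.inE eqxx.
Qed.

Let mem_ins P (B : {set 'I_r}) : ((h @: B)%SET \in ins P) = (B \in P).
Proof. by rewrite finset.in_setU1 (negbTE (im_e B)) /= mem_imset //; exact: imset_inj. Qed.

Let link_ins P a b : ([set h a; h b]%SET \in ins P) = ([set a; b]%SET \in P).
Proof. by rewrite -mem_ins imsetU1 imset_set1. Qed.

Let ins_inj : injective ins.
Proof. by move=> P Q PQ; apply/setP => B; rewrite -!mem_ins PQ. Qed.

Let insP P B : B \in ins P -> B = e \/ exists2 B', B' \in P & B = (h @: B')%SET.
Proof.
rewrite finset.in_setU1 => /orP[/eqP|/imsetP[B' B'P ->]]; first by left.
by right; exists B'.
Qed.

Let e2 : #|e| = 2.
Proof. by rewrite cards2 -val_eqE /= i0E i1E; case: eqP => //; lia. Qed.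

Let link_insP P x y : [set x; y]%SET \in ins P ->
  [set x; y]%SET = e \/ exists a b, [/\ x = h a, y = h b & [set a; b]%SET \in P].
Proof.
move=> xyP; case: (insP xyP) => [->|[B BP xyB]]; first by left.
have /imsetP[a aB xa] : x \in (h @: B)%SET by rewrite -xyB !finset.inE eqxx.
have /imsetP[b bB yb] : y \in (h @: B)%SET by rewrite -xyB !finset.inE eqxx orbT.
by right; exists a, b; split=> //; rewrite -link_ins -xa -yb.
Qed.

Let ins_NC2 P : (ins P \in NC2 r.+2) = (P \in NC2 r).
Proof.
apply/NC2P/NC2P => -[Pc P2 Pt nc]; split.
- move=> a; have [y [ay]] := Pc (h a).
  case/link_insP => [ae|[a' [b [/h_inj <- yb abP]]]].
    by have := he a; rewrite -ae !finset.inE eqxx.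
  by exists b; split=> //; apply: contraNneq ay => ->; rewrite yb.
- by move=> B; rewrite -mem_ins => /P2; rewrite card_imset.
- move=> B B' a; rewrite -!mem_ins => BP B'P aB aB'; apply: (imset_inj h_inj).
  by apply: (Pt _ _ (h a)) => //; exact: imset_f.
- move=> x1 y1 x2 y2; rewrite -!link_ins => h1 h2; rewrite -!h_lt; exact: nc.
- move=> x; have [xe|/hS[a ->]] := boolP (x \in e).
    have eP : e \in ins P by rewrite !finset.inE eqxx.
    have i01 : i0 != i1 by rewrite -val_eqE /= i0E i1E; case: eqP => //; lia.
    move: xe; rewrite !finset.inE => /orP[]/eqP->; [exists i1|exists i0] => //.
    by rewrite eq_sym finset.setUC.
  have [b [ab abP]] := Pc a; exists (h b); rewrite link_ins; split=> //.
  by apply: contraNneq ab => /h_inj->.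
- by move=> B /insP[->//|[B' /P2 <- ->]]; rewrite card_imset.
- move=> A B x /insP[->|[A' A'P ->]] /insP[->|[B' B'P ->]]//.
  + by move=> xe /imsetP[a _ xa]; have := he a; rewrite -xa xe.
  + by move=> /imsetP[a _ ->] ae; have := he a; rewrite ae.
  + move=> /imsetP[a aA ->] /imsetP[b bB /h_inj ab].
    by rewrite (Pt A' B' a)//; rewrite ab.
- have eE (x y : 'I_r.+2) : [set x; y]%SET = e -> (x < y)%N -> x = i :> nat /\ y = i.+1 :> nat.
    move=> xye xy; have : x \in e by rewrite -xye !finset.inE eqxx.
    have : y \in e by rewrite -xye !finset.inE eqxx orbT.
    by rewrite !finset.inE -!val_eqE /= i0E i1E; lia.
  move=> x1 y1 x2 y2 /link_insP[xye|[a1 [b1 [-> -> P1]]]].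
    move=> _; apply/negP => /and3P[l1 l2 l3].
    by have [] := eE _ _ xye (ltn_trans l1 l2); lia.
  case/link_insP => [xye|[a2 [b2 [-> -> P2']]]]; last by rewrite !h_lt; exact: nc.
  apply/negP => /and3P[l1 l2 l3].
  by have [] := eE _ _ xye (ltn_trans l2 l3); lia.
Qed.

Let ins_openers P : openers i.+1 (ins P) = openers i P.
Proof.
apply/openersP/openersP => op x y xy yi.
  by rewrite -link_ins op ?h_lt ?h_lti.
apply/negP => /link_insP[xye|[a [b [xa yb abP]]]].
  have : y \in e by rewrite -xye !finset.inE eqxx orbT.
  have : x \in e by rewrite -xye !finset.inE eqxx.
  by rewrite !finset.inE -!val_eqE /= i0E i1E; lia.
by have := op a b; rewrite abP -h_lt -xa -yb xy -h_lti -yb yi => /(_ isT isT).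
Qed.

Let ins_surj Q : Q \in NC2 r.+2 -> e \in Q -> exists P, Q = ins P.
Proof.
move=> /NC2P[_ _ Pt _] eQ; exists [set B : {set 'I_r} | (h @: B)%SET \in Q]%SET.
apply/setP => B; rewrite finset.in_setU1.
apply/idP/orP => [BQ|[/eqP->//|/imsetP[B']]]; last by rewrite finset.inE => ? ->.
have [->|Be] := eqVneq B e; [by left|right].
have BE : B = (h @: (h @^-1: B))%SET.
  apply/setP => x; apply/idP/imsetP => [xB|[a]]; last by rewrite finset.inE => ? ->.
  have [xe|/hS[a xa]] := boolP (x \in e).
    by case/eqP: Be; exact: (Pt _ _ x).
  by exists a => //; rewrite finset.inE -xa.
by rewrite BE; apply/imset_f; rewrite finset.inE -BE.
Qed.

Let weight_ins (f : nat -> I) P : pairing_weight f (ins P) =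
  c (f i) (f i.+1) * pairing_weight (fun a => f (skip2 i a)) P.
Proof.
have eQ : e \in ins P by rewrite !finset.inE eqxx.
rewrite {1}/pairing_weight (bigD1 (i0, i1)) /= ?i0E ?i1E ?ltnSn//.
congr (_ * _); pose hh (p : 'I_r * 'I_r) := (h p.1, h p.2).
rewrite (@big_inj_image _ _ _ _ _ hh).
- apply: eq_big => [[a b]|[a b] _] /=; last by rewrite !hE.
  rewrite h_lt link_ins; apply/andb_idr => _.
  by apply: contraNneq (he a) => -[-> _]; rewrite !finset.inE eqxx.
- by move=> [a b] [a' b'] [/h_inj-> /h_inj->].
move=> [x y] /= /andP[/andP[xy /link_insP[xye|[a [b [-> -> _]]]]]]; last by exists (a, b).
have : y \in e by rewrite -xye !finset.inE eqxx orbT.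
have : x \in e by rewrite -xye !finset.inE eqxx.
rewrite !finset.inE => xe ye /eqP[]; move: xe ye xy.
by move=> /orP[]/eqP-> /orP[]/eqP->; rewrite ?i0E ?i1E//; lia.
Qed.

Lemma open_sum_close (f : nat -> I) :
  \sum_(P in NC2 r.+2 | openers i.+1 P &&
       [exists x : 'I_r.+2, exists y : 'I_r.+2,
          [&& (x.+1 == i.+1)%N, (y == i.+1 :> nat)%N & [set x; y]%SET \in P]])
      pairing_weight f P =
  c (f i) (f i.+1) * open_sum r i (fun a => f (skip2 i a)).
Proof.
have exE (P : {set {set 'I_r.+2}}) : [exists x : 'I_r.+2, exists y : 'I_r.+2,
          [&& (x.+1 == i.+1)%N, (y == i.+1 :> nat)%N & [set x; y]%SET \in P]]
     = (e \in P).
  apply/existsP/idP => [[x /existsP[y /and3P[/eqP[xi] /eqP yi]]]|eP].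
    have -> : x = i0 by apply/val_inj; rewrite /= i0E.
    by have -> : y = i1 by apply/val_inj; rewrite /= i1E.
  by exists i0; apply/existsP; exists i1; rewrite i0E i1E !eqxx.
rewrite (@big_inj_image _ _ _ _ _ ins) => [|//|P]; last first.
  by rewrite exE => /and3P[PN _ eP]; exact: ins_surj.
rewrite /open_sum big_distrr /=; apply: eq_big => [P|P _]; last exact: weight_ins.
by rewrite exE ins_NC2 ins_openers !finset.inE eqxx andbT.
Qed.

End insert_adjacent_pair.

Variable x0 : I.

(** The sum over the noncrossing pairings of the word [rev s ++ u] none of
    whose arcs lies inside the prefix [rev s]: the letters of [s] are waiting
    for a partner, the last read one being on top. *)
Definition stack_sum (s u : seq I) : C :=
  open_sum (size s + size u) (size s) (nth x0 (rev s ++ u)).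

Lemma stack_sum_nil s : stack_sum s [::] = (nilp s)%:R.
Proof. by rewrite /stack_sum addn0 open_sum_all. Qed.

(** Reading the letter [x], one either pushes it on the stack or pairs it with
    the top of the stack. *)
Lemma stack_sum_cons s x u : stack_sum s (x :: u) = stack_sum (x :: s) u +
  (if s is y :: s' then c y x * stack_sum s' u else 0).
Proof.
rewrite /stack_sum open_sum_split /=; last by rewrite addnS ltnS leq_addr.
rewrite addSnnS rev_cons cat_rcons; congr (_ + _).
case: s => [|y s] /=.
  by rewrite big1// => P /and3P[_ _ /existsP[z /existsP[]]].
rewrite addSn addnS open_sum_close ?leq_addr//.
rewrite rev_cons cat_rcons !nth_cat size_rev ltnn subnn /= ltnNge leqnSn /=.
rewrite subSnn /=; congr (_ * _); apply: eq_open_sum => a _.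
rewrite !nth_cat size_rev /skip2; case: (ltnP a (size s)) => [->//|sa].
by rewrite ltnNge (leq_trans sa) ?leqW//= !subSn// leqW.
Qed.

End noncrossing_pairings.

(** * Wick words and Chebyshev polynomials *)

Section chebyshev.
Variable R : realType.

(** The Chebyshev polynomials of the second kind on [[-2, 2]], by their
    three-term recursion. *)
Fixpoint chebyshevU (n : nat) : {poly R} :=
  match n with
  | 0 => 1
  | n'.+1 => if n' is n''.+1 then chebyshevU n' * 'X - chebyshevU n'' else 'X
  end.

Lemma chebyshevUSS n : chebyshevU n.+2 = chebyshevU n.+1 * 'X - chebyshevU n.
Proof. by []. Qed.

Lemma is_chebyshevU_chebyshevU n : is_chebyshevU n (chebyshevU n).
Proof.
suff [] : is_chebyshevU n (chebyshevU n) /\ is_chebyshevU n.+1 (chebyshevU n.+1)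
  by [].
elim: n => [|n [IH0 IH1]].
  split=> th s0; first by rewrite hornerC mul1r divff.
  rewrite hornerX (_ : 2%:R * th = th + th); last by ring.
  by rewrite sinD; apply: (mulIf s0); rewrite divfK//; ring.
split=> // th s0; rewrite chebyshevUSS hornerD hornerN hornerM hornerX IH0// IH1//.
apply: (mulIf s0); rewrite mulrBl mulrAC !divfK//.
have -> : n.+3%:R * th = n.+2%:R * th + th by rewrite -[n.+3%:R]natr1; ring.
have -> : n.+1%:R * th = n.+2%:R * th - th by rewrite -[n.+2%:R]natr1; ring.
by rewrite sinB sinD; ring.
Qed.

End chebyshev.

(** The value of [phi (wick s * (\sum_(k < m) U_n(X_k)) ^ r)], see
    [phi_wick_mul_chebyshev_sum]. Each factor [U_n(X_k)] counts as [n] copies of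
    the letter [k]: the first [j] of them are paired with the [j] letters on top
    of the stack [s], the other [n - j] are pushed. *)
Fixpoint wick_moment (R : realType) (c : nat -> nat -> R) (m n r : nat)
    (s : seq nat) : R :=
  if r is r'.+1 then
    \sum_(k < m) \sum_(0 <= j < n.+1 | (j <= size s)%N)
      (\prod_(x <- take j s) c x k) *
      wick_moment c m n r' (nseq (n - j) (k : nat) ++ drop j s)
  else (nilp s)%:R.

Section wick.
Variables (R : realType) (A : wstar_prob_space R) (X : nat -> A).
Variable c : nat -> nat -> R.

Let phiD (a b : A) : phi (a + b) = phi a + phi b.
Proof. by have := @phi_linear R A 1 a b; rewrite scale1r mul1r. Qed.

Let phiZ t (a : A) : phi (t *: a) = t * phi a.
Proof.
have phi0 : phi (0 : A) = 0 by apply: (addIr (phi (0 : A))); rewrite -phiD addr0 add0r.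
by have := @phi_linear R A t a 0; rewrite !addr0 phi0 addr0.
Qed.

Let phi_sum (J : Type) (l : seq J) (P : pred J) (F : J -> A) :
  phi (\sum_(j <- l | P j) F j) = \sum_(j <- l | P j) phi (F j).
Proof.
apply: (big_morph _ phiD); by have := phiZ 0 0; rewrite scale0r mul0r.
Qed.

(** The Wick word of a stack [s], whose head is the last letter read: the product
    of the letters of [rev s] with all the contractions removed. *)
Fixpoint wick (s : seq nat) : A :=
  if s is x :: s' then
    wick s' * X x - (if s' is y :: s'' then (c y x)%:C *: wick s'' else 0)
  else 1.

Lemma wick_mulX s x : wick s * X x =
  wick (x :: s) + (if s is y :: s' then (c y x)%:C *: wick s' else 0).
Proof. by case: s => [|y s]; rewrite [wick (x :: _)]/= subrK. Qed.

Arguments wick : simpl never.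

Hypothesis X_cov : forall j k, phi (X j * X k) = (c j k)%:C.
Hypothesis X_semicircular : semicircular_family X.

Let cC (j k : nat) : R[i] := (c j k)%:C.

Lemma phi_word (u : seq nat) :
  phi (\prod_(a <- u) X a) = stack_sum cC 0%N [::] u.
Proof.
have [_ _ /(_ (size u) (fun a => nth 0%N u a)) momX] := X_semicircular.
rewrite (big_nth 0%N) big_mkord momX /stack_sum /open_sum add0n /=.
apply: eq_big => [P|P _]; last by apply: eq_bigr => p _; rewrite X_cov.
by rewrite andb_idr// => _; apply/openersP.
Qed.

(** Subtracting the contractions in [wick s] amounts to forbidding the arcs
    between letters of [s]. *)
Lemma phi_wick_word (s u : seq nat) :
  phi (wick s * \prod_(a <- u) X a) = stack_sum cC 0%N s u.
Proof.
have [N] := ubnP (size s); elim: N s u => // N IH [|x s] u sN.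
  by rewrite mul1r phi_word.
have -> : wick (x :: s) * \prod_(a <- u) X a = wick s * \prod_(a <- x :: u) X a +
  (-1) *: (if s is y :: s' then (c y x)%:C *: (wick s' * \prod_(a <- u) X a) else 0).
  rewrite big_cons mulrA wick_mulX [in RHS]mulrDl; case: s {sN} => [|y s].
    by rewrite mul0r scaler0 !addr0.
  by rewrite scaleN1r scalerAl addrK.
rewrite phiD phiZ IH// stack_sum_cons mulN1r; case: s sN => [|y s] sN.
  by have := phiZ 0 0; rewrite scale0r mul0r => ->; rewrite oppr0 !addr0.
by rewrite phiZ IH ?addrK//; exact: ltnW.
Qed.

Lemma phi_wick (s : seq nat) : phi (wick s) = (nilp s)%:R.
Proof. by have := phi_wick_word s [::]; rewrite big_nil mulr1 stack_sum_nil. Qed.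

Lemma real_horner_cheb0 (a : A) : real_horner (chebyshevU R 0) a = 1.
Proof. by rewrite /real_horner !rmorph1. Qed.

Lemma real_horner_cheb1 (a : A) : real_horner (chebyshevU R 1) a = a.
Proof. by rewrite /real_horner /= map_polyX horner_algX. Qed.

Lemma real_horner_chebSS n (a : A) : real_horner (chebyshevU R n.+2) a =
  real_horner (chebyshevU R n.+1) a * a - real_horner (chebyshevU R n) a.
Proof.
by rewrite /real_horner chebyshevUSS rmorphB rmorphM /= map_polyX rmorphB rmorphM /= horner_algX.
Qed.

(** The product formula for Wick words. Since [c k k = 1], the copies of [k]
    cancel against each other in the Chebyshev recursion and are only paired
    with letters of [s]. *)
Lemma wick_mul_chebyshev n k s : c k k = 1 ->
  wick s * real_horner (chebyshevU R n) (X k) =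
  \sum_(0 <= j < n.+1 | (j <= size s)%N)
     (\prod_(x <- take j s) c x k)%:C *: wick (nseq (n - j) k ++ drop j s).
Proof.
move=> ck; pose Q n := wick s * real_horner (chebyshevU R n) (X k) =
  \sum_(0 <= j < n.+1 | (j <= size s)%N)
     (\prod_(x <- take j s) c x k)%:C *: wick (nseq (n - j) k ++ drop j s).
suff [] : Q n /\ Q n.+1 by [].
elim: n => [|n [IH0 IH1]]; split=> //; rewrite /Q.
- rewrite real_horner_cheb0 mulr1 big_mkcond big_nat1 /= take0 drop0 big_nil.
  by rewrite scale1r.
- rewrite real_horner_cheb1 wick_mulX big_mkcond big_nat_recr//= big_nat1.
  rewrite take0 drop0 big_nil scale1r; congr (_ + _).
  by case: s {Q} => [//|y s] /=; rewrite take0 drop0 big_seq1.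
rewrite real_horner_chebSS mulrBr mulrA IH1 IH0.
rewrite mulr_suml [in RHS]big_mkcond big_nat_recr//= -big_mkcond /=.
rewrite [in LHS]big_mkcond big_nat_recr//= -big_mkcond /=.
rewrite [in RHS]big_mkcond big_nat_recr//= -big_mkcond /=.
have -> : \sum_(0 <= j < n.+1 | (j <= size s)%N)
   (\prod_(x <- take j s) c x k)%:C *: wick (nseq (n.+1 - j) k ++ drop j s) * X k =
   \sum_(0 <= j < n.+1 | (j <= size s)%N)
   (\prod_(x <- take j s) c x k)%:C *: wick (nseq (n.+2 - j) k ++ drop j s) +
   \sum_(0 <= j < n.+1 | (j <= size s)%N)
   (\prod_(x <- take j s) c x k)%:C *: wick (nseq (n - j) k ++ drop j s).
  rewrite -big_split /= big_nat_cond [RHS]big_nat_cond; apply: eq_bigr => j /andP[/andP[_ jn] _].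
  rewrite -scalerAl wick_mulX scalerDr; congr (_ *: _ + _ *: _).
    by rewrite !subSn//; apply: leqW.
  by rewrite subSn//= ck scale1r.
rewrite -!addrA; congr (_ + _); rewrite addrC -!addrA addrC.
rewrite addNr add0r; case: (ltnP n (size s)) => [ns|sn]; last first.
  by rewrite ltnNge (leq_trans sn)//= addr0.
rewrite subnn subSnn /= -scalerAl wick_mulX scalerDr; congr (_ + _).
case: (ltnP n.+1 (size s)) => [ns1|sn]; last by rewrite drop_oversize//= scaler0.
rewrite (drop_nth 0%N ns1) (take_nth 0%N ns1) subnn /= -cats1 big_cat big_seq1.
by rewrite rmorphM scalerA.
Qed.

Hypothesis c1 : forall k, c k k = 1.

Lemma phi_wick_mul_chebyshev_sum m n r s :
  phi (wick s * (\sum_(k < m) real_horner (chebyshevU R n) (X k)) ^+ r) =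
  (wick_moment c m n r s)%:C.
Proof.
elim: r s => [|r IH] s; first by rewrite expr0 mulr1 phi_wick rmorph_nat.
rewrite exprS mulrA mulr_sumr mulr_suml phi_sum /= rmorph_sum.
apply: eq_bigr => k _; rewrite wick_mul_chebyshev// mulr_suml phi_sum rmorph_sum.
by apply: eq_bigr => j _; rewrite -scalerAl phiZ IH rmorphM.
Qed.

End wick.

(** * Asymptotics of the moments of a Chebyshev sum *)

(** A substitute for the inequality of arithmetic and geometric means: bound
    each factor by the largest one. *)
Lemma prod_le_sum_exp (R : realDomainType) (I : eqType) (l : seq I) (a : I -> R) :
  (forall x, 0 <= a x) -> ~~ nilp l ->
  \prod_(x <- l) a x <= \sum_(x <- l) a x ^+ size l.
Proof.
move=> a0 l0; have [M Ml Mmax] : exists2 M, M \in l & {in l, forall x, a x <= a M}.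
  elim: l l0 => // x [|y l] IH _.
    by exists x => [|z]; rewrite mem_seq1 // => /eqP->.
  have [//|M Ml Mmax] := IH; have [Mx|xM] := leP (a M) (a x).
    exists x => [|z]; first exact: mem_head.
    by rewrite in_cons => /orP[/eqP->//|/Mmax/le_trans]; exact.
  exists M => [|z]; first by rewrite in_cons Ml orbT.
  by rewrite in_cons => /orP[/eqP->|/Mmax//]; exact: ltW.
apply: (@le_trans _ _ (a M ^+ size l)).
  have -> : a M ^+ size l = \prod_(x <- l) a M.
    by rewrite big_const_seq count_predT iter_mulr_1.
  rewrite big_seq [leRHS]big_seq.
  by apply: ler_prod => x xl; rewrite a0 Mmax.
rewrite (big_rem M)//= lerDl; apply: sumr_ge0 => x _; exact: exprn_ge0.
Qed.

Lemma cvg_sum_seq (R : realType) (I : Type) (l : seq I) (P : pred I)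
    (u : nat -> I -> R) (v : I -> R) :
  (forall i, P i -> u m i @[m --> \oo] --> v i) ->
  \sum_(i <- l | P i) u m i @[m --> \oo] --> \sum_(i <- l | P i) v i.
Proof.
move=> uv; elim: l => [|i l IH].
  by under eq_fun do rewrite big_nil; rewrite big_nil; exact: cvg_cst.
under eq_fun do rewrite big_cons; rewrite big_cons.
by case: ifP => Pi //; apply: cvgD => //; exact: uv.
Qed.

(** The quantity [d] stands for [m ^ (- 1 / (2 n))], and [E j] bounds the cost of
    contracting [j] letters with a new letter summed over [k < m]. *)
Section moment_bound.
Variables (R : realType) (c : nat -> nat -> R) (m n : nat) (d : R) (E : nat -> R).
Hypothesis d_gt0 : 0 < d.
Hypothesis d_root : d ^+ (2 * n) * m%:R = 1.
Hypothesis E_bound : forall j w, (j <= n)%N -> (w < m)%N ->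
  d ^+ (2 * (n - j)) * \sum_(k < m) `|c w k| ^+ j <= E j.

Let d_ge0 : 0 <= d. Proof. exact: ltW. Qed.

Let m_gt0 : (0 < m)%N.
Proof. by rewrite lt0n; apply: contra_eq_neq d_root => ->; rewrite mulr0 eq_sym oner_neq0. Qed.

Let E_ge0 j : (j <= n)%N -> 0 <= E j.
Proof.
move=> jn; apply: le_trans (E_bound jn m_gt0).
by rewrite mulr_ge0 ?exprn_ge0// sumr_ge0// => k _; exact: exprn_ge0.
Qed.

(** The case [j = 0] uses [1 <= E 0], which is [E_bound] for [j = w = 0]. *)
Lemma contraction_bound j (s : seq nat) : (j <= n)%N -> (j <= size s)%N ->
  all (fun x => x < m)%N s ->
  d ^+ (2 * (n - j)) * \sum_(k < m) \prod_(x <- take j s) `|c x k| <= n.+1%:R * E j.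
Proof.
move=> jn js ms; have [->|j0] := posnP j.
  apply: (@le_trans _ _ (E 0%N)); last first.
    by apply: ler_peMl; rewrite ?E_ge0// ler1n.
  apply: le_trans (E_bound (leq0n n) m_gt0).
  rewrite ler_wpM2l ?exprn_ge0//; apply: ler_sum => k _.
  by rewrite take0 big_nil expr0.
apply: (@le_trans _ _ (\sum_(x <- take j s) E j)); last first.
  rewrite big_const_seq count_predT iter_addr_0 size_takel// -[leLHS]mulr_natl.
  by rewrite ler_wpM2r ?E_ge0// ler_nat leqW.
apply: (@le_trans _ _ (\sum_(x <- take j s) d ^+ (2 * (n - j)) * \sum_(k < m) `|c x k| ^+ j)).
  rewrite -mulr_sumr ler_wpM2l ?exprn_ge0// exchange_big /=.
  apply: ler_sum => k _; have := @prod_le_sum_exp R _ (take j s) (fun x => `|c x k|).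
  by rewrite size_takel//; apply => //; rewrite /nilp size_takel// -lt0n.
rewrite big_seq [leRHS]big_seq; apply: ler_sum => x /mem_take xs.
by apply: E_bound => //; move/allP: ms; apply.
Qed.

Let K := \sum_(0 <= j < n.+1) n.+1%:R * E j.

Let K_ge0 : 0 <= K.
Proof.
rewrite /K big_nat; apply: sumr_ge0 => j; rewrite ltnS => jn.
by rewrite mulr_ge0// E_ge0.
Qed.

(** Every contraction of order [j] shortens the stack by [2 j - n], and the
    resulting power of [d] compensates the growth of the sum over the new
    letter: the normalized moments stay bounded. *)
Lemma wick_moment_bound r (s : seq nat) : all (fun x => x < m)%N s ->
  `|d ^+ (n * r) * wick_moment c m n r s| <= K ^+ r * d ^+ size s.
Proof.
elim: r s => [|r IH] s ms.
  rewrite muln0 !mul1r; case: s {ms} => [|x s] /=; first by rewrite normr1.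
  by rewrite normr0 exprn_ge0.
rewrite normrM (ger0_norm (exprn_ge0 _ d_ge0)) /=.
apply: (@le_trans _ _ (d ^+ (n * r.+1) * \sum_(k < m) \sum_(0 <= j < n.+1 | (j <= size s)%N)
   (\prod_(x <- take j s) `|c x k|) *
      `|wick_moment c m n r (nseq (n - j) (k : nat) ++ drop j s)|)).
  rewrite ler_wpM2l ?exprn_ge0//; apply: le_trans (ler_norm_sum _ _ _) _.
  apply: ler_sum => k _; apply: le_trans (ler_norm_sum _ _ _) _.
  by apply: ler_sum => j _; rewrite normrM normr_prod.
rewrite exchange_big /= exprSr -mulrA mulr_sumr.
have -> : K ^+ r * (K * d ^+ size s) =
   \sum_(0 <= j < n.+1) K ^+ r * d ^+ size s * (n.+1%:R * E j).
  by rewrite -mulr_sumr -/K; ring.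
rewrite [leLHS]big_mkcond big_nat [leRHS]big_nat.
apply: ler_sum => j; rewrite ltnS => /= jn; case: ifP => [js|_]; last first.
  by rewrite !mulr_ge0 ?exprn_ge0// E_ge0.
apply: (@le_trans _ _ (K ^+ r * d ^+ size s *
   (d ^+ (2 * (n - j)) * \sum_(k < m) \prod_(x <- take j s) `|c x k|))); last first.
  by rewrite ler_wpM2l ?mulr_ge0 ?exprn_ge0// contraction_bound.
rewrite mulrCA !mulr_sumr; apply: ler_sum => k _.
set P := \prod_(_ <- _) _; set W := wick_moment _ _ _ _ _.
have P0 : 0 <= P by apply: prodr_ge0.
have /IH : all (fun x => x < m)%N (nseq (n - j) (k : nat) ++ drop j s).
  rewrite all_cat all_nseq ltn_ord orbT /=; apply/allP => x /mem_drop xs.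
  by move/allP: ms; apply.
rewrite -/W normrM (ger0_norm (exprn_ge0 _ d_ge0)) size_cat size_nseq size_drop => IHW.
have -> : d ^+ (n * r.+1) * (P * `|W|) = P * d ^+ n * (d ^+ (n * r) * `|W|).
  by rewrite mulnS exprD; ring.
apply: (@le_trans _ _ (P * d ^+ n * (K ^+ r * d ^+ (n - j + (size s - j))))).
  by rewrite ler_wpM2l// mulr_ge0// exprn_ge0.
have -> : P * d ^+ n * (K ^+ r * d ^+ (n - j + (size s - j))) =
  K ^+ r * P * d ^+ (n + (n - j + (size s - j))) by rewrite [in RHS]exprD; ring.
rewrite (_ : (n + (n - j + (size s - j)) = size s + 2 * (n - j))%N); last by lia.
by rewrite exprD le_eqVlt; apply/orP; left; apply/eqP; ring.
Qed.

End moment_bound.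

Section block_sum.
Variables (R : realType) (m n : nat).

(** The sum of [F] over the stacks made of [a] blocks of [n] equal letters. *)
Fixpoint block_sum (a : nat) (F : seq nat -> R) : R :=
  if a is a'.+1 then
    \sum_(k < m) block_sum a' (fun s => F (nseq n (k : nat) ++ s))
  else F [::].

Lemma eq_block_sum a F G :
  (forall s, size s = (n * a)%N -> F s = G s) -> block_sum a F = block_sum a G.
Proof.
elim: a F G => [|a IH] F G FG /=; first by apply: FG; rewrite muln0.
apply: eq_bigr => k _; apply: IH => s sn; apply: FG.
by rewrite size_cat size_nseq sn mulnS.
Qed.

Lemma block_sum_sum a (J : Type) (l : seq J) (P : pred J) (F : J -> seq nat -> R) :
  block_sum a (fun s => \sum_(j <- l | P j) F j s) =
  \sum_(j <- l | P j) block_sum a (F j).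
Proof.
elim: a F => [//|a IH] F /=; rewrite exchange_big /=; apply: eq_bigr => k _.
by rewrite IH.
Qed.

Lemma block_sumZ a t F : block_sum a (fun s => t * F s) = t * block_sum a F.
Proof.
elim: a F => [//|a IH] F /=; rewrite mulr_sumr; apply: eq_bigr => k _.
by rewrite IH.
Qed.

Lemma block_sum_le a F B :
  (forall s, size s = (n * a)%N -> all (fun x => x < m)%N s -> `|F s| <= B) ->
  `|block_sum a F| <= m%:R ^+ a * B.
Proof.
elim: a F => [|a IH] F FB /=; first by rewrite mul1r FB// muln0.
apply: le_trans (ler_norm_sum _ _ _) _.
apply: (@le_trans _ _ (\sum_(k < m) m%:R ^+ a * B)).
  apply: ler_sum => k _; apply: IH => s sn sm; apply: FB.
    by rewrite size_cat size_nseq sn mulnS.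
  by rewrite all_cat all_nseq ltn_ord orbT sm.
by rewrite sumr_const card_ord -[leLHS]mulr_natl exprS mulrA.
Qed.

End block_sum.

Section block_recursion.
Variables (R : realType) (c : nat -> nat -> R) (m n : nat) (d : R) (E : nat -> R).
Hypothesis n_gt0 : (0 < n)%N.
Hypothesis d_gt0 : 0 < d.
Hypothesis d_root : d ^+ (2 * n) * m%:R = 1.
Hypothesis E_bound : forall j w, (j <= n)%N -> (w < m)%N ->
  d ^+ (2 * (n - j)) * \sum_(k < m) `|c w k| ^+ j <= E j.

Let d_ge0 : 0 <= d. Proof. exact: ltW. Qed.

(** The sum of [phi (wick s * V_m ^ r)] over the stacks [s] made of [a] blocks
    [k ^ n], multiplied by [m ^ (- a / 2)]. *)
Definition block_moment (a r : nat) : R :=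
  d ^+ (n * (a + r)) * block_sum m n a (wick_moment c m n r).

Lemma block_moment0 a : block_moment a 0 = (a == 0)%N%:R.
Proof.
case: a => [|a]; first by rewrite /block_moment /= muln0 mul1r.
rewrite /block_moment /= big1 ?mulr0// => k _; rewrite -[RHS](mul0r (block_sum m n a (fun=> 1))).
rewrite -block_sumZ; apply: eq_block_sum => s _; rewrite mul0r.
by case: (n) n_gt0.
Qed.

Lemma block_moment_first r : block_moment 0 r.+1 = block_moment 1 r.
Proof.
rewrite /block_moment /= add0n add1n; congr (_ * _); apply: eq_bigr => k _.
rewrite big_mkcond big_nat_recl//= big_nil mul1r subn0.
by rewrite big1 ?addr0// => j _; rewrite ltn0.
Qed.

Let K := \sum_(0 <= j < n.+1) n.+1%:R * E j.

(* the terms of block_moment a.+1 r.+1 in which the new letter k is contracted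
   j times with the block of the letter l on top of the stack *)
Let contracted (a r j : nat) : R :=
  \sum_(l < m) \sum_(k < m) c l k ^+ j *
     block_sum m n a (fun s => wick_moment c m n r
       (nseq (n - j) (k : nat) ++ nseq (n - j) (l : nat) ++ s)).

Let block_sum_moment a r : block_sum m n a.+1 (wick_moment c m n r.+1) =
  \sum_(0 <= j < n.+1) contracted a r j.
Proof.
rewrite /contracted exchange_big /=; apply: eq_bigr => l _; rewrite exchange_big /=.
rewrite (@eq_block_sum _ _ _ _ _ (fun s => \sum_(k < m) \sum_(0 <= j < n.+1)
    c l k ^+ j * wick_moment c m n r
       (nseq (n - j) (k : nat) ++ nseq (n - j) (l : nat) ++ s))).
  rewrite block_sum_sum; apply: eq_bigr => k _; rewrite block_sum_sum.
  by apply: eq_bigr => j _; rewrite block_sumZ.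
move=> s sn; apply: eq_bigr => k _.
rewrite big_mkcond !big_nat; apply: eq_bigr => j; rewrite ltnS => /= jn.
rewrite size_cat size_nseq (leq_trans jn (leq_addr _ _)).
rewrite takel_cat ?size_nseq// take_nseq// big_nseq iter_mulr_1.
rewrite drop_cat size_nseq drop_nseq; have [//|nj] := ltnP j n.
have -> : j = n by apply/eqP; rewrite eqn_leq jn.
by rewrite subnn drop0.
Qed.

Let contracted_bound a r j : (j <= n)%N ->
  `|d ^+ (n * (a.+1 + r.+1)) * contracted a r j| <= K ^+ r * E j.
Proof.
move=> jn; have m_gt0 : (0 < m)%N.
  by rewrite lt0n; apply: contra_eq_neq d_root => ->; rewrite mulr0 eq_sym oner_neq0.
have K0 : 0 <= K.
  rewrite /K big_nat; apply: sumr_ge0 => i; rewrite ltnS => i_n.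
  rewrite mulr_ge0//; apply: le_trans (E_bound i_n m_gt0).
  by rewrite mulr_ge0 ?exprn_ge0// sumr_ge0// => k _; exact: exprn_ge0.
set D := d ^+ _; have D0 : 0 <= D by exact: exprn_ge0.
rewrite normrM (ger0_norm D0).
pose B := m%:R ^+ a * (K ^+ r * d ^+ (2 * (n - j) + n * a) / d ^+ (n * r)).
have B0 : 0 <= B by rewrite !mulr_ge0 ?invr_ge0 ?exprn_ge0 ?K0.
have bsB l k : (l < m)%N -> (k < m)%N -> `|block_sum m n a (fun s => wick_moment c m n r
       (nseq (n - j) k ++ nseq (n - j) l ++ s))| <= B.
  move=> lm km; apply: block_sum_le => s sn sm.
  rewrite ler_pdivlMr ?exprn_gt0// mulrC.
  rewrite -[X in X * `|_|]ger0_norm ?exprn_ge0// -normrM.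
  rewrite (_ : (2 * (n - j) + n * a)%N = size (nseq (n - j) k ++ nseq (n - j) l ++ s)).
    apply: wick_moment_bound => //.
    by rewrite !all_cat !all_nseq lm km !orbT.
  by rewrite !size_cat !size_nseq sn; lia.
apply: (@le_trans _ _ (D * \sum_(l < m) \sum_(k < m) `|c l k| ^+ j * B)).
  rewrite ler_wpM2l//; apply: le_trans (ler_norm_sum _ _ _) _.
  apply: ler_sum => l _; apply: le_trans (ler_norm_sum _ _ _) _.
  apply: ler_sum => k _; rewrite normrM normrX ler_wpM2l ?exprn_ge0//.
  exact: bsB.
have DB : D * B = K ^+ r * d ^+ (2 * n) * d ^+ (2 * (n - j)).
  rewrite /D /B (_ : (n * (a.+1 + r.+1) = n * a + 2 * n + n * r)%N); last by lia.
  have dr : d ^+ (n * r) != 0 by rewrite expf_neq0// gt_eqF.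
  have da : d ^+ (n * a) * d ^+ (n * a) * m%:R ^+ a = 1.
    rewrite (_ : d ^+ (n * a) * d ^+ (n * a) = (d ^+ (2 * n)) ^+ a).
      by rewrite -exprMn d_root expr1n.
    by rewrite -exprD -exprM; congr (_ ^+ _); lia.
  rewrite (exprD d (2 * (n - j)) (n * a)) (exprD d _ (n * r)) (exprD d (n * a)).
  move: da; move: (d ^+ (n * a)) (d ^+ (2 * (n - j))) (d ^+ (2 * n)) (K ^+ r) => x1 x2 x3 x4.
  move: (m%:R ^+ a) (d ^+ (n * r)) dr => x5 x6 x60 da.
  transitivity ((x1 * x1 * x5) * (x4 * x3 * x2)); last by rewrite da mul1r.
  by field.
rewrite (eq_bigr (fun l : 'I_m => (\sum_(k < m) `|c l k| ^+ j) * B)) => [|l _]; last by rewrite mulr_suml.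
rewrite -mulr_suml mulrCA DB mulrC -!mulrA ler_wpM2l ?exprn_ge0// mulr_sumr.
apply: (@le_trans _ _ (d ^+ (2 * n) * \sum_(l < m) E j)).
  rewrite ler_wpM2l ?exprn_ge0//; apply: ler_sum => l _; exact: E_bound.
by rewrite sumr_const card_ord -[X in _ * X]mulr_natl mulrA d_root mul1r.
Qed.

(** Only two ways to treat the new letter are not negligible: pushing a whole
    block ([j = 0]) and removing a whole block ([j = n]). *)
Lemma block_moment_step a r :
  `|block_moment a.+1 r.+1 - (block_moment a.+2 r +
     d ^+ (2 * n) * (\sum_(l < m) \sum_(k < m) c l k ^+ n) * block_moment a r)|
  <= K ^+ r * \sum_(1 <= j < n) E j.
Proof.
set S := \sum_(l < m) \sum_(k < m) _.
suff -> : block_moment a.+1 r.+1 - (block_moment a.+2 r +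
     d ^+ (2 * n) * S * block_moment a r) =
     \sum_(1 <= j < n) d ^+ (n * (a.+1 + r.+1)) * contracted a r j.
  apply: le_trans (ler_norm_sum _ _ _) _.
  rewrite mulr_sumr !big_nat; apply: ler_sum => j /andP[_ jn].
  by apply: contracted_bound; exact: ltnW.
rewrite -mulr_sumr {1}/block_moment block_sum_moment.
rewrite big_nat_recr//= big_ltn//= !mulrDr.
have -> : d ^+ (n * (a.+1 + r.+1)) * contracted a r 0 = block_moment a.+2 r.
  rewrite /block_moment addnS addSn; congr (_ * _).
  rewrite /contracted exchange_big /=; apply: eq_bigr => k _; apply: eq_bigr => l _.
  by rewrite mul1r subn0.
have -> : d ^+ (n * (a.+1 + r.+1)) * contracted a r n = d ^+ (2 * n) * S * block_moment a r.
  rewrite /block_moment (_ : (n * (a.+1 + r.+1) = 2 * n + n * (a + r))%N); last by lia.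
  rewrite exprD -!mulrA; congr (_ * _); rewrite mulrCA; congr (_ * _).
  rewrite /S mulr_suml; apply: eq_bigr => l _; rewrite mulr_suml; apply: eq_bigr => k _.
  by rewrite subnn.
by ring.
Qed.

End block_recursion.

(** The limit of [block_moment _ _ _ _ a r]: the number of ways to close [a] open
    arcs using [r] further points, each of which opens an arc or closes the
    last open one, with a weight [s] for each closing. For [a = 0] this is the
    [r]-th moment of [S(0,s)]. *)
Fixpoint arc_moment (R : realType) (s : R) (a r : nat) : R :=
  if r is r'.+1 then
    arc_moment s a.+1 r' + (if a is a'.+1 then s * arc_moment s a' r' else 0)
  else (a == 0)%N%:R.

Section block_limit.
Variables (R : realType) (c : nat -> nat -> R) (n : nat) (d : nat -> R).
Variables (E : nat -> nat -> R) (B s : R).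
Hypothesis n_gt0 : (0 < n)%N.
Hypothesis d_gt0 : forall m, 0 < d m.
Hypothesis d_root : forall m, d m ^+ (2 * n) * m.+1%:R = 1.
Hypothesis E_bound : forall m j w, (j <= n)%N -> (w < m.+1)%N ->
  d m ^+ (2 * (n - j)) * \sum_(k < m.+1) `|c w k| ^+ j <= E m j.
Hypothesis E_bounded : forall m j, (j <= n)%N -> E m j <= B.
Hypothesis E_cvg0 : forall j, (0 < j < n)%N -> E m j @[m --> \oo] --> 0.
Hypothesis cov_cvg :
  d m ^+ (2 * n) * (\sum_(l < m.+1) \sum_(k < m.+1) c l k ^+ n) @[m --> \oo] --> s.

(** The recursion [block_moment_step] passes to the limit. *)
Lemma block_moment_cvg a r :
  block_moment c m.+1 n (d m) a r @[m --> \oo] --> arc_moment s a r.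
Proof.
elim: r a => [|r IH] a.
  under eq_fun do rewrite block_moment0//; exact: cvg_cst.
case: a => [|a].
  under eq_fun do rewrite block_moment_first; rewrite /= addr0; exact: IH.
pose K m := \sum_(0 <= j < n.+1) n.+1%:R * E m j.
pose KB := \sum_(0 <= j < n.+1) n.+1%:R * B.
pose main m := block_moment c m.+1 n (d m) a.+2 r +
     d m ^+ (2 * n) * (\sum_(l < m.+1) \sum_(k < m.+1) c l k ^+ n) *
     block_moment c m.+1 n (d m) a r.
have main_cvg : main m @[m --> \oo] --> arc_moment s a.+1 r.+1.
  by apply: cvgD; [exact: IH|apply: cvgM => //; exact: IH].
have E0 m j : (j <= n)%N -> 0 <= E m j.
  move=> jn; apply: le_trans (E_bound (w := 0) jn _) => //.
  rewrite mulr_ge0 ?exprn_ge0 ?(ltW (d_gt0 m))//.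
  by apply: sumr_ge0 => k _; exact: exprn_ge0.
have err_cvg : KB ^+ r * \sum_(1 <= j < n) E m j @[m --> \oo] --> 0.
  rewrite -[X in _ --> X](mulr0 (KB ^+ r)); apply: cvgM; first exact: cvg_cst.
  rewrite [X in _ --> X](_ : 0 = \sum_(1 <= j < n | (1 <= j < n)%N) 0); last by rewrite big1.
  under eq_fun do rewrite big_nat.
  by apply: (@cvg_sum_seq _ _ _ _ E (fun=> 0)) => j; exact: E_cvg0.
have le_err m : `|block_moment c m.+1 n (d m) a.+1 r.+1 - main m| <=
    KB ^+ r * \sum_(1 <= j < n) E m j.
  apply: le_trans (block_moment_step n_gt0 (d_gt0 m) (d_root m) (@E_bound m) a r) _.
  rewrite ler_wpM2r//.
    by rewrite big_nat sumr_ge0// => j /andP[_ jn]; apply: E0; exact: ltnW.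
  have K0 : 0 <= K m.
    by rewrite /K big_nat sumr_ge0// => j; rewrite ltnS => jn; rewrite mulr_ge0 ?E0.
  rewrite lerXn2r ?nnegrE//; last first.
    rewrite /KB /K !big_nat; apply: ler_sum => j; rewrite ltnS => /= jn.
    by rewrite ler_wpM2l// E_bounded.
  rewrite /KB big_nat sumr_ge0// => j; rewrite ltnS => jn.
  by rewrite mulr_ge0// (le_trans (E0 0%N j jn))// E_bounded.
have diff_cvg : block_moment c m.+1 n (d m) a.+1 r.+1 - main m @[m --> \oo] --> 0.
  apply: (@squeeze_cvgr _ _ _ _ (fun m => - (KB ^+ r * \sum_(1 <= j < n) E m j))
    (fun m => KB ^+ r * \sum_(1 <= j < n) E m j)) => //.
    by near=> m; rewrite -ler_norml; exact: le_err.
  by have h := cvgN err_cvg; rewrite oppr0 in h; exact: h.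
have h := cvgD diff_cvg main_cvg; rewrite add0r in h; apply: (cvg_trans _ (h _)).
by apply: near_eq_cvg; near=> m; rewrite /= subrK.
Unshelve. all: by end_near. Qed.

End block_limit.

(** The case of an empty stack, that is, of the moments of [V_m]. *)
Lemma moment_sum_cvg (R : realType) (c : nat -> nat -> R) (n : nat) (d : nat -> R)
    (E : nat -> nat -> R) (B s : R) (r : nat) :
  (0 < n)%N -> (forall m, 0 < d m) -> (forall m, d m ^+ (2 * n) * m.+1%:R = 1) ->
  (forall m j w, (j <= n)%N -> (w < m.+1)%N ->
     d m ^+ (2 * (n - j)) * \sum_(k < m.+1) `|c w k| ^+ j <= E m j) ->
  (forall m j, (j <= n)%N -> E m j <= B) ->
  (forall j, (0 < j < n)%N -> E m j @[m --> \oo] --> 0) ->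
  d m ^+ (2 * n) * (\sum_(l < m.+1) \sum_(k < m.+1) c l k ^+ n) @[m --> \oo] --> s ->
  d m ^+ (n * r) * wick_moment c m.+1 n r [::] @[m --> \oo] --> arc_moment s 0 r.
Proof.
move=> n0 d0 dr Eb EB E0 cs.
exact: (block_moment_cvg (a := 0) (r := r) n0 d0 dr Eb EB E0 cs).
Qed.

(** * Summable covariances *)

(** A sum over [k < M] of a function of the distance from [k] to [w]. *)
Lemma sum_dist (V : nmodType) (g : nat -> V) M w : (w < M)%N ->
  \sum_(k < M) g (w - k + (k - w))%N =
  \sum_(0 <= i < w) g i.+1 + \sum_(0 <= i < M - w) g i.
Proof.
move=> wM; rewrite -(big_mkord xpredT (fun k => g (w - k + (k - w))%N)).
rewrite (big_cat_nat (n := w))//=; last exact: ltnW.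
congr (_ + _).
  rewrite big_nat_rev /= big_nat [RHS]big_nat; apply: eq_bigr => i /= iw.
  by congr g; lia.
rewrite -{1}[w]add0n big_addn; apply: eq_bigr => i _.
by congr g; lia.
Qed.

(** A two-term Young inequality with a free constant [eta] in front of the
    first term. *)
Lemma young_eta (R : realFieldType) (n j : nat) (a x eta : R) :
  (0 < j < n)%N -> 0 <= a -> 0 <= x -> 0 < eta <= 1 ->
  a ^+ (n - j) * x ^+ j <= eta * a ^+ n + eta^-1 ^+ n * x ^+ n.
Proof.
move=> /andP[j0 jn] a0 x0 /andP[e0 e1].
have [xa|ax] := leP x (eta * a).
  apply: (@le_trans _ _ (eta * a ^+ n)); last first.
    by rewrite lerDl mulr_ge0 ?exprn_ge0// invr_ge0 ltW.
  apply: (@le_trans _ _ (a ^+ (n - j) * (eta * a) ^+ j)).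
    by rewrite ler_wpM2l ?exprn_ge0// lerXn2r ?nnegrE// mulr_ge0// ltW.
  rewrite exprMn mulrCA -exprD subnK ?(ltnW jn)// ler_wpM2r ?exprn_ge0//.
  by case: j j0 {jn} => // j _; rewrite exprS ler_piMr ?(ltW e0)// exprn_ile1// ltW.
apply: (@le_trans _ _ (eta^-1 ^+ n * x ^+ n)); last first.
  by rewrite lerDr mulr_ge0 ?exprn_ge0// ltW.
have ax' : a <= eta^-1 * x by rewrite ler_pdivlMl// ltW.
apply: (@le_trans _ _ ((eta^-1 * x) ^+ (n - j) * x ^+ j)).
  by rewrite ler_wpM2r ?exprn_ge0// lerXn2r ?nnegrE// mulr_ge0// invr_ge0 ltW.
rewrite exprMn -mulrA -exprD subnK ?(ltnW jn)// ler_wpM2r ?exprn_ge0//.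
by apply: ler_weXn2l; [rewrite invf_ge1|exact: leq_subr].
Qed.

Lemma young1 (R : realFieldType) (n j : nat) (a x : R) :
  (j <= n)%N -> 0 <= a -> 0 <= x -> a ^+ (n - j) * x ^+ j <= a ^+ n + x ^+ n.
Proof.
move=> jn a0 x0; have [xa|/ltW ax] := leP x a.
  apply: (@le_trans _ _ (a ^+ (n - j) * a ^+ j)).
    by rewrite ler_wpM2l ?exprn_ge0// lerXn2r.
  by rewrite -exprD subnK// lerDl exprn_ge0.
apply: (@le_trans _ _ (x ^+ (n - j) * x ^+ j)).
  by rewrite ler_wpM2r ?exprn_ge0// lerXn2r.
by rewrite -exprD subnK// lerDr exprn_ge0.
Qed.

Lemma bounded_series_cvg (R : realType) (u : nat -> R) (C : R) :
  (forall N, \sum_(0 <= k < N) `|u k| <= C) -> cvgn (series u).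
Proof.
move=> uC; apply: normed_cvg; apply: nondecreasing_is_cvgn.
  by apply: nondecreasing_series => k _ _ /=.
by exists C => _ [N _ <-]; exact: uC.
Qed.

Section stationary.
Variables (R : realType) (f : nat -> R) (n : nat) (C : R).
Hypothesis n_gt0 : (0 < n)%N.
Hypothesis f_summable : forall N, \sum_(0 <= l < N) `|f l| ^+ n <= C.

(* the truncated differences add up to the distance of k and l *)
Let cov (k l : nat) : R := f (k - l + (l - k))%N.

(** The sequence [d m] is the normalization for [m + 1] summands. *)
Lemma exists_root : exists d : nat -> R, [/\ forall m, 0 < d m,
  forall m, d m ^+ (2 * n) * m.+1%:R = 1 & d m @[m --> \oo] --> 0].
Proof.
pose d m : R := m.+1%:R `^ (- (2 * n)%:R^-1).
have d0 m : 0 < d m by rewrite powR_gt0.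
have dr m : d m ^+ (2 * n) * m.+1%:R = 1.
  rewrite -powR_mulrn ?ltW// -powRrM mulNr mulVf; last first.
    by rewrite pnatr_eq0 -lt0n muln_gt0.
  by rewrite powR_inv1// mulVf// pnatr_eq0.
exists d; split=> //; apply/cvgrPdist_lt => e e0.
have e2 : 0 < e ^+ (2 * n) by exact: exprn_gt0.
near=> m.
rewrite sub0r normrN gtr0_norm// -(@ltr_pXn2r _ (2 * n)) ?nnegrE ?ltW//; last first.
  by rewrite muln_gt0.
have -> : d m ^+ (2 * n) = m.+1%:R^-1.
  by apply: (mulIf (x := m.+1%:R)); rewrite ?pnatr_eq0// dr mulVf// pnatr_eq0.
by near: m; exact: near_infty_natSinv_lt (PosNum e2).
Unshelve. all: by end_near. Qed.

Lemma tail_small e : 0 < e ->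
  exists M, forall N, (M <= N)%N -> \sum_(M <= l < N) `|f l| ^+ n <= e.
Proof.
move=> e0; pose u N := \sum_(0 <= l < N) `|f l| ^+ n.
have u_nd : nondecreasing_seq u.
  apply/nondecreasing_seqP => N; rewrite /u big_nat_recr//= lerDl; exact: exprn_ge0.
have u_cvg : cvgn u.
  by apply: nondecreasing_is_cvgn => //; exists C => _ [N _ <-]; exact: f_summable.
have /cvgrPdist_lt/(_ e e0)[M _ HM] := u_cvg.
exists M => N MN.
have -> : \sum_(M <= l < N) `|f l| ^+ n = u N - u M.
  by rewrite /u [X in _ = X - _](big_cat_nat (n := M))//= addrAC subrr add0r.
have := HM M (leqnn M); have := nondecreasing_cvgn_le u_nd u_cvg N.
move=> uN /ltr_normlW; lra.
Qed.

(** Summing over [k] first, [l] sees the covariances up to distance [l] on one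
    side and up to [m - l] on the other; after a reversal these are partial
    sums of the two one-sided series, and Cesaro's theorem applies. *)
Lemma cov_mean_cvg :
  m.+1%:R^-1 * (\sum_(l < m.+1) \sum_(k < m.+1) cov l k ^+ n) @[m --> \oo] -->
  limn (series (fun k => f k ^+ n)) + limn (series (fun k => f k.+1 ^+ n)).
Proof.
have f_cvg : cvgn (series (fun k => f k ^+ n)).
  apply: bounded_series_cvg => N.
  by under eq_bigr do rewrite normrX; exact: f_summable.
have f1_cvg : cvgn (series (fun k => f k.+1 ^+ n)).
  apply: bounded_series_cvg => N.
  apply: le_trans (f_summable N.+1); rewrite big_nat_recl//=.
  under eq_bigr do rewrite normrX; rewrite lerDr; exact: exprn_ge0.
pose u l := series (fun k => f k.+1 ^+ n) l + series (fun k => f k ^+ n) l.+1.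
have u_cvg : u l @[l --> \oo] -->
  limn (series (fun k => f k ^+ n)) + limn (series (fun k => f k.+1 ^+ n)).
  rewrite addrC; apply: cvgD => //.
  by rewrite (cvg_shiftS (series (fun k => f k ^+ n))).
have := cesaro u_cvg; apply: cvg_trans; apply: near_eq_cvg; near=> m.
rewrite /arithmetic_mean /=; congr (_ * _); rewrite /series /=.
rewrite /u big_split /= big_mkord [in RHS](eq_bigr (fun l : 'I_m.+1 =>
  \sum_(0 <= i < l) f i.+1 ^+ n + \sum_(0 <= i < m.+1 - l) f i ^+ n)); last first.
  by move=> l _; rewrite -(@sum_dist _ (fun i => f i ^+ n)).
rewrite big_split /=; congr (_ + _).
rewrite -(big_mkord xpredT (fun l => \sum_(0 <= i < m.+1 - l) f i ^+ n)).
rewrite [RHS]big_nat_rev /= big_nat [RHS]big_nat; apply: eq_bigr => l /= lm.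
by congr (\sum_(0 <= i < _) _); lia.
Unshelve. all: by end_near. Qed.

(** The moments of [V_m] converge when the covariance of [j] and [k] is a function
    [f] of their distance with [\sum_l |f l| ^ n] finite. *)
Lemma stationary_moment_cvg r :
  (Num.sqrt m%:R)^-1 ^+ r * wick_moment cov m n r [::] @[m --> \oo] -->
  arc_moment (limn (series (fun k => f k ^+ n)) +
              limn (series (fun k => f k.+1 ^+ n))) 0 r.
Proof.
have [d [d0 dr dcvg]] := exists_root.
have d20 m : 0 <= d m ^+ 2 by exact/exprn_ge0/ltW.
pose E m j := d m ^+ (2 * (n - j)) * (2 * \sum_(0 <= l < m.+1) `|f l| ^+ j).
have d2n m : d m ^+ (2 * n) = m.+1%:R^-1.
  by apply: (mulIf (x := m.+1%:R)); rewrite ?pnatr_eq0// dr mulVf// pnatr_eq0.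
have C0 : 0 <= C by have := f_summable 0; rewrite big_nil.
rewrite -(cvg_shiftS (fun m => (Num.sqrt m%:R)^-1 ^+ r * wick_moment cov m n r [::])) /=.
have sqrtE m : (Num.sqrt m.+1%:R)^-1 ^+ r = d m ^+ (n * r).
  rewrite exprM; congr (_ ^+ _); apply: (mulIf (x := Num.sqrt m.+1%:R)).
    by rewrite gt_eqF// sqrtr_gt0.
  rewrite mulVf; last by rewrite gt_eqF// sqrtr_gt0.
  apply/esym/eqP; rewrite -(@eqrXn2 _ 2)// ?mulr_ge0 ?sqrtr_ge0 ?exprn_ge0 ?(ltW (d0 m))//.
  by rewrite exprMn sqr_sqrtr// expr1n -exprM mulnC dr.
under eq_fun do rewrite sqrtE.
apply: (@moment_sum_cvg _ _ _ _ E (2 * (1 + C))) => //.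
- move=> m j w jn wm; rewrite ler_wpM2l ?exprn_ge0 ?(ltW (d0 m))//.
  rewrite /cov (@sum_dist _ (fun i => `|f i| ^+ j))// [leRHS]mulr_natl mulr2n.
  apply: lerD.
    rewrite [leRHS](big_cat_nat (n := w.+1))//= big_nat_recl//= -addrA addrCA lerDl.
    by rewrite addr_ge0 ?sumr_ge0 ?exprn_ge0// => i _; exact: exprn_ge0.
  rewrite [leRHS](big_cat_nat (n := m.+1 - w))//= ?leq_subr// lerDl.
  by rewrite sumr_ge0// => i _; exact: exprn_ge0.
- move=> m j jn; rewrite /E mulrCA ler_wpM2l// exprM mulr_sumr.
  apply: (@le_trans _ _ (\sum_(0 <= l < m.+1) (m.+1%:R^-1 + `|f l| ^+ n))).
    apply: ler_sum => l _; rewrite -d2n exprM; exact: young1.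
  rewrite big_split /= lerD// sumr_const_nat subn0 -[leLHS]mulr_natl.
  by rewrite mulfV// pnatr_eq0.
(* for 0 < j < n: the distances l < M contribute a multiple of
   d ^ (2 (n - j)), the others are split by Young's inequality into a term
   eta / (m + 1) per summand and a multiple of the tail of the series *)
- move=> j jn; apply/cvgrPdist_le => e e0.
  (* e / 6, because of the factor 2 in E and of the three parts of the sum *)
  pose eta := Num.min 1 (e / 6).
  have eta01 : 0 < eta <= 1 by rewrite /eta lt_min ltr01 divr_gt0//= ge_min lexx.
  have eta_e : eta <= e / 6 by rewrite /eta ge_min lexx orbT.
  have /andP[eta0 eta1] := eta01.
  have [|M HM] := @tail_small (eta ^+ n * (e / 6)).
    by rewrite mulr_gt0 ?exprn_gt0 ?divr_gt0.
  pose S := \sum_(0 <= l < M) `|f l| ^+ j.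
  have S0 : 0 <= S by rewrite sumr_ge0// => l _; exact: exprn_ge0.
  have small : d m ^+ (2 * (n - j)) * S @[m --> \oo] --> 0.
    rewrite -[X in _ --> X](mul0r S); apply: cvgM; last exact: cvg_cst.
    have dk k : d m ^+ k.+1 @[m --> \oo] --> 0.
      elim: k => [//|k IHk]; rewrite -[X in _ --> X](mul0r 0).
      by under eq_fun do rewrite exprS; apply: cvgM.
    by have -> : (2 * (n - j) = (2 * (n - j)).-1.+1)%N; [lia|exact: dk].
  move/cvgrPdist_le : small => /(_ (e / 6)) small.
  near=> m; rewrite sub0r normrN ger0_norm; last first.
    apply: mulr_ge0; first by rewrite exprn_ge0// ltW.
    by apply: mulr_ge0 => //; apply: sumr_ge0 => l _; exact: exprn_ge0.
  have Mm : (M <= m.+1)%N by apply: leqW; near: m; exact: nbhs_infty_ge.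
  rewrite /E mulrCA (big_cat_nat (n := M))//= mulrDr.
  have : `|0 - d m ^+ (2 * (n - j)) * S| <= e / 6.
    by near: m; apply: small; rewrite divr_gt0.
  rewrite sub0r normrN ger0_norm; last by rewrite mulr_ge0 ?exprn_ge0 ?(ltW (d0 m)).
  rewrite -/S => small_m.
  have tail : d m ^+ (2 * (n - j)) * \sum_(M <= l < m.+1) `|f l| ^+ j <= e / 6 + e / 6.
    apply: (@le_trans _ _ (\sum_(M <= l < m.+1)
       (eta * m.+1%:R^-1 + eta^-1 ^+ n * `|f l| ^+ n))).
      rewrite mulr_sumr; apply: ler_sum => l _; rewrite -d2n !exprM.
      exact: young_eta.
    rewrite big_split /= lerD//.
      rewrite sumr_const_nat -[leLHS]mulr_natl mulrCA; apply: le_trans eta_e.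
      rewrite ler_piMr ?(ltW eta0)// ler_pdivrMr// mul1r ler_nat; exact: leq_subr.
    rewrite -mulr_sumr exprVn ler_pdivrMl ?exprn_gt0//; exact: HM.
  lra.
by under eq_fun do rewrite d2n; exact: cov_mean_cvg.
Unshelve. all: by end_near. Qed.

End stationary.

(** * Polynomial approximation *)

Section bernstein.
Variable R : realFieldType.
Implicit Types (h : nat -> R) (y : R).

(** The expectation of [h] under the binomial law of parameters [n] and ['X],
    that is, the Bernstein polynomial with values [h] at the nodes. *)
Fixpoint bernstein (n : nat) h : {poly R} :=
  if n is n'.+1 then
    (1 - 'X) * bernstein n' h + 'X * bernstein n' (fun k => h k.+1)
  else (h 0%N)%:P.

Lemma bernstein0 h y : (bernstein 0 h).[y] = h 0%N.
Proof. by rewrite hornerC. Qed.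

Lemma bernsteinS n h y : (bernstein n.+1 h).[y] =
  (1 - y) * (bernstein n h).[y] + y * (bernstein n (fun k => h k.+1)).[y].
Proof. by rewrite /= !hornerE. Qed.

Lemma bernstein_le n h1 h2 y : 0 <= y <= 1 -> (forall k, h1 k <= h2 k) ->
  (bernstein n h1).[y] <= (bernstein n h2).[y].
Proof.
move=> /andP[y0 y1]; elim: n h1 h2 => [|n IH] h1 h2 h12.
  by rewrite !bernstein0.
by rewrite !bernsteinS lerD// ler_wpM2l// ?subr_ge0// IH.
Qed.

Lemma bernstein_linear n h1 h2 (b1 b2 : R) y :
  (bernstein n (fun k => b1 * h1 k + b2 * h2 k)).[y] =
  b1 * (bernstein n h1).[y] + b2 * (bernstein n h2).[y].
Proof.
elim: n h1 h2 => [|n IH] h1 h2; first by rewrite !bernstein0.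
by rewrite !bernsteinS !IH; ring.
Qed.

Lemma bernstein_cst n (a y : R) : (bernstein n (fun=> a)).[y] = a.
Proof.
by elim: n => [|n IH]; rewrite ?bernstein0// bernsteinS IH; ring.
Qed.

(** The variance of the binomial law. *)
Lemma bernstein_sqr n (c y : R) : (bernstein n (fun k => (k%:R - c) ^+ 2)).[y] =
  n%:R * y * (1 - y) + (n%:R * y - c) ^+ 2.
Proof.
elim: n c => [|n IH] c; first by rewrite bernstein0; ring.
rewrite bernsteinS IH.
rewrite (_ : (fun k => (k.+1%:R - c) ^+ 2) = (fun k => (k%:R - (c - 1)) ^+ 2)).
  by rewrite IH -natr1; ring.
by apply/funext => k; rewrite -natr1; congr (_ ^+ 2); ring.
Qed.

End bernstein.

Section weierstrass.
Variable R : realType.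

(** Uniform continuity on a compact interval; [y] may lie outside. *)
Lemma heine (f : R -> R) (K e : R) : continuous f -> 0 < e ->
  exists2 d, 0 < d & forall x y, `|x| <= K -> `|x - y| < d -> `|f x - f y| < e.
Proof.
move=> cf e0; have cK : compact `[(- K), K]%classic by exact: segment_compact.
move/compact_near_coveringP : cK => /(_ R (nbhs 0^'+)
  (fun d x => forall y, `|x - y| < d -> `|f x - f y| < e)) H.
have /H[] : forall x, `[(- K), K]%classic x -> \forall x' \near x & i \near 0^'+,
    forall y, `|x' - y| < i -> `|f x' - f y| < e.
  move=> x _; have e20 : 0 < e / 2 by rewrite divr_gt0.
  have /cvgrPdist_lt/(_ _ e20) := cf x; move=> /nbhs_ballP[d /= d0 dP].
  exists (ball x (d / 2), [set i | i < d / 2]) => /=.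
    split; first by apply: nbhsx_ballx; rewrite divr_gt0.
    by near=> i; near: i; apply: nbhs_right_lt; rewrite divr_gt0.
  move=> [x' i] /= [xx' id] y x'y.
  rewrite /ball /= in xx'.
  have h1 : `|f x - f x'| < e / 2.
    by apply: dP; rewrite /ball /=; apply: lt_trans xx' _; lra.
  have h2 : `|f x - f y| < e / 2.
    apply: dP; rewrite /ball /= -(subrKA x').
    apply: le_lt_trans (ler_normD _ _) _; lra.
  rewrite -(subrKA (f x)); apply: le_lt_trans (ler_normD _ _) _.
  rewrite distrC; lra.
move=> d /= d0 dP; exists (d / 2); first by rewrite divr_gt0.
move=> x y xK xy; apply: (dP (d / 2)) => //.
- rewrite /ball /= sub0r normrN gtr0_norm ?divr_gt0//; lra.
- by rewrite /= divr_gt0.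
- by rewrite /= in_itv/= -ler_norml.
Unshelve. all: by end_near. Qed.

(** Weierstrass's theorem, by Bernstein's proof: the variance of the binomial law
    controls the contribution of the nodes far from [x]. *)
Theorem weierstrass (f : R -> R) (M K e : R) : continuous f ->
  (forall x, `|f x| <= M) -> 0 < K -> 0 < e ->
  exists p : {poly R}, forall x, `|x| <= K -> `|f x - p.[x]| <= e.
Proof.
move=> cf fM K0 e0; have e20 : 0 < e / 2 by rewrite divr_gt0.
have [d d0 dP] := heine K cf e20.
have M0 : 0 <= M by exact: le_trans (fM 0).
(* two values of f differ by at most e/2 if the points are d-close, and by at
   most 2 M otherwise *)
have fxy x y : `|x| <= K -> `|f y - f x| <= e / 2 + 2 * M / d ^+ 2 * (y - x) ^+ 2.
  move=> xK; have [xy|xy] := ltP `|x - y| d.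
    apply: ltW; apply: lt_le_trans (_ : e / 2 <= _).
      by rewrite distrC dP.
    by rewrite lerDl mulr_ge0 ?sqr_ge0// divr_ge0 ?sqr_ge0// mulr_ge0.
  apply: (@le_trans _ _ (2 * M)).
    apply: le_trans (ler_normB _ _) _; have := fM x; have := fM y; lra.
  apply: (@le_trans _ _ (2 * M / d ^+ 2 * (y - x) ^+ 2)); last by rewrite lerDr ltW.
  rewrite mulrAC ler_pdivlMr ?exprn_gt0// ler_wpM2l ?mulr_ge0//.
  by rewrite -[leRHS]real_normK ?num_real// distrC lerXn2r ?nnegrE// ltW.
pose C := 2 * M / d ^+ 2 * (2 * K) ^+ 2.
have C0 : 0 <= C by rewrite /C mulr_ge0 ?sqr_ge0// divr_ge0 ?sqr_ge0// mulr_ge0.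
have [n n0 Cn] : exists2 n, (0 < n)%N & C / n%:R <= e / 2.
  exists (Num.bound (C / (e / 2))).+1 => //.
  rewrite ler_pdivrMr ?ltr0n// mulrC -ler_pdivrMr//.
  apply: ltW; apply: lt_le_trans (archi_boundP _) _; first by rewrite divr_ge0// ltW.
  by rewrite ler_nat.
have n0' : n%:R != 0 :> R by rewrite pnatr_eq0 -lt0n.
pose node (k : nat) : R := 2 * K / n%:R * k%:R - K.
pose p := bernstein n (fun k => f (node k)) \Po ((2 * K)^-1 *: ('X + K%:P)).
exists p => x xK; rewrite horner_comp !hornerE.
set y := (2 * K)^-1 * (x + K).
have y01 : 0 <= y <= 1.
  rewrite /y mulrC; move: xK; rewrite ler_norml => /andP[x1 x2].
  rewrite divr_ge0 ?ler_pdivrMr ?mulr_gt0//=; lra.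
have xE : x = 2 * K * y - K by rewrite /y; field; rewrite gt_eqF.
have nodeE k : node k - x = 2 * K / n%:R * (k%:R - n%:R * y).
  by rewrite xE /node; field.
pose D k := e / 2 * 1 + (2 * M / d ^+ 2 * (2 * K / n%:R) ^+ 2) * (k%:R - n%:R * y) ^+ 2.
have fD k : `|f (node k) - f x| <= D k.
  apply: le_trans (fxy _ (node k) xK) _.
  by rewrite nodeE /D le_eqVlt; apply/orP; left; apply/eqP; ring.
have De : (bernstein n D).[y] <= e.
  rewrite /D (bernstein_linear _ (fun=> 1) (fun k => (k%:R - n%:R * y) ^+ 2)).
  rewrite bernstein_cst bernstein_sqr subrr expr0n addr0 mulr1.
  have -> : 2 * M / d ^+ 2 * (2 * K / n%:R) ^+ 2 * (n%:R * y * (1 - y)) =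
    C / n%:R * (y * (1 - y)) by rewrite /C; field; rewrite n0' gt_eqF.
  rewrite [leRHS](splitr e) lerD2l; apply: le_trans Cn.
  rewrite ler_piMr ?divr_ge0//; move: y01 => /andP[y0 y1].
  by rewrite mulr_ile1 ?subr_ge0// gerBl.
have E : f x - (bernstein n (fun k => f (node k))).[y] =
   (bernstein n (fun k => f x * 1 + (-1) * f (node k))).[y].
  by rewrite (bernstein_linear _ (fun=> 1)) bernstein_cst; ring.
have up : (bernstein n (fun k => f x * 1 + (-1) * f (node k))).[y] <= (bernstein n D).[y].
  by apply: bernstein_le => // k; have := fD k; rewrite ler_norml => /andP[]; lra.
have : (bernstein n (fun k => (-1) * D k + 0 * 1)).[y] <=
    (bernstein n (fun k => f x * 1 + (-1) * f (node k))).[y].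
  by apply: bernstein_le => // k; have := fD k; rewrite ler_norml => /andP[]; lra.
rewrite (bernstein_linear _ D (fun=> 1)) => lo.
by rewrite E ler_norml; apply/andP; split; lra.
Qed.

End weierstrass.

(** * The method of moments *)

Section integrable_powers.
Variables (R : realType) (P : {measure set (measurableTypeR R) -> \bar R}).
Hypothesis P1 : P setT = 1%E.
Hypothesis P_pow : forall r : nat, P.-integrable setT (fun t => (t ^+ r)%:E).

Lemma integrable_horner (p : {poly R}) : P.-integrable setT (fun t => (p.[t])%:E).
Proof.
apply: (eq_integrable _ (fun t : measurableTypeR R => \sum_(i < size p) (p`_i)%:E * (t ^+ i)%:E)%E) => //.
  by move=> t _; rewrite horner_coef -sumEFin; apply: eq_bigr => i _; rewrite EFinM.
by apply: integrable_sum => // i _; exact: integrableZl.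
Qed.

Lemma Rintegral_horner (p : {poly R}) : Rintegral P setT (fun t => p.[t]) =
  \sum_(i < size p) p`_i * Rintegral P setT (fun t => t ^+ i).
Proof.
under eq_Rintegral do rewrite horner_coef.
elim: (size p) => [|n IH].
  under eq_Rintegral do rewrite big_ord0; rewrite big_ord0.
  by rewrite Rintegral_cst// mul0r.
under eq_Rintegral do rewrite big_ord_recr /=.
rewrite big_ord_recr /= -IH RintegralD//.
- by congr (_ + _); rewrite RintegralZl//; exact: P_pow.
- apply: (eq_integrable _ (fun t : measurableTypeR R => \sum_(i < n) (p`_i)%:E * (t ^+ i)%:E)%E) => //.
    by move=> t _ /=; rewrite -sumEFin; apply: eq_bigr => i _; rewrite EFinM.
  by apply: integrable_sum => // i _; exact: integrableZl.
- by apply: (eq_integrable _ (fun t : measurableTypeR R => (p`_n)%:E * (t ^+ n)%:E)%E) => //; exact: integrableZl.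
Qed.

Lemma integrable_bounded_continuous (f : R -> R) : continuous f -> bounded_fun f ->
  P.-integrable setT (EFin \o f).
Proof.
move=> cf bf; apply: measurable_bounded_integrable => //.
  by rewrite P1 ltry.
exact: continuous_measurable_fun.
Qed.

Lemma le_Rintegral_even_power (g : R -> R) (e b : R) (N : nat) :
  P.-integrable setT (EFin \o g) ->
  (forall x, `|g x| <= e + b * x ^+ (2 * N)) ->
  `|Rintegral P setT g| <= e + b * Rintegral P setT (fun t => t ^+ (2 * N)).
Proof.
move=> ig gb; apply: le_trans (le_normr_Rintegral _ ig) _ => //.
have ie : P.-integrable setT (EFin \o (fun _ : R => e)).
  apply: integrable_bounded_continuous; first by move=> x; exact: cvg_cst.
  by exists `|e|; split; [exact: num_real|move=> x /ltW ex y _ /=].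
have iN : P.-integrable setT (fun t => (b * t ^+ (2 * N))%:E).
  apply: (eq_integrable _ (fun t : measurableTypeR R => b%:E * (t ^+ (2 * N))%:E)%E) => //.
  exact: integrableZl.
have -> : e + b * Rintegral P setT (fun t => t ^+ (2 * N)) =
    Rintegral P setT (fun t => e + b * t ^+ (2 * N)).
  by rewrite RintegralD// Rintegral_cst// RintegralZl//= ?P1 ?mulr1//; exact: P_pow.
apply: le_Rintegral => //.
- exact: integrable_norm ig.
- exact: (integrableD measurableT ie iN).
Qed.

End integrable_powers.

(** Convergence of moments implies weak convergence when the even moments of the
    limit grow at most geometrically, that is, when the limit has compact
    support. No uniform bound on the supports of the [mu m] is needed. *)
Theorem moments_weak_cvg (R : realType)
    (mu : nat -> {measure set (measurableTypeR R) -> \bar R})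
    (nu : {measure set (measurableTypeR R) -> \bar R}) (K : R) :
  0 < K -> nu setT = 1%E -> (forall m, mu m setT = 1%E) ->
  (forall r : nat, nu.-integrable setT (fun t => (t ^+ r)%:E)) ->
  (forall m (r : nat), (mu m).-integrable setT (fun t => (t ^+ r)%:E)) ->
  (forall N : nat, Rintegral nu setT (fun t => t ^+ (2 * N)) <= K ^+ (2 * N)) ->
  (forall r : nat, Rintegral (mu m) setT (fun t => t ^+ r) @[m --> \oo] -->
     Rintegral nu setT (fun t => t ^+ r)) ->
  weak_cvg mu nu.
Proof.
move=> K0 nu1 mu1 nui mui nuK mucvg f cf bf.
have [M fM] : exists M, forall x, `|f x| <= M.
  have [M [Mr MP]] := bf; exists (M + 1) => x.
  by apply: (MP (M + 1)) => //; rewrite ltrDl.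
have M0 : 0 <= M by exact: le_trans (fM 0).
(* on [-L, L] the approximation is uniform; since L is larger than K, the
   moments of order 2 N divided by L ^ (2 N) tend to 0 *)
apply/cvgrPdist_le => e e0; pose L := 2 * K.
have L0 : 0 < L by rewrite mulr_gt0.
have e5 : 0 < e / 5 by rewrite divr_gt0.
have [p pP] := weierstrass cf fM L0 e5.
pose C := M + \sum_(i < size p) `|p`_i| * L ^+ i.
have C0 : 0 <= C by rewrite addr_ge0// sumr_ge0// => i _; rewrite mulr_ge0// exprn_ge0// ltW.
have [N [pN CN]] : exists N, (size p <= 2 * N)%N /\ C * (2^-1) ^+ (2 * N) <= e / 10.
  have : C * (2^-1 ^+ n) @[n --> \oo] --> 0.
    rewrite -[X in _ --> X](mulr0 C); apply: cvgM; first exact: cvg_cst.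
    by apply: cvg_expr; rewrite ger0_norm ?invr_ge0// invf_lt1// ltr1n.
  have e10 : 0 < e / 10 by rewrite divr_gt0.
  move=> /cvgrPdist_le/(_ _ e10)[n0 _ Hn].
  exists (n0 + size p)%N; split; first by lia.
  have := Hn (2 * (n0 + size p))%N; rewrite /= sub0r normrN ger0_norm.
    by apply; lia.
  by rewrite mulr_ge0// exprn_ge0// invr_ge0.
have LE (x : R) : `|x| ^+ (2 * N) = x ^+ (2 * N).
  by rewrite exprM real_normK ?num_real// -exprM.
(* beyond L, both f and p are dominated by a high even power of x / L *)
have fp x : `|f x - p.[x]| <= e / 5 + C / L ^+ (2 * N) * x ^+ (2 * N).
  have [xL|xL] := leP `|x| L.
    apply: le_trans (pP x xL) _; rewrite lerDl -(LE x); apply: mulr_ge0; last exact: exprn_ge0.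
    by rewrite divr_ge0// exprn_ge0// ltW.
  apply: (@le_trans _ _ (C / L ^+ (2 * N) * x ^+ (2 * N))); last first.
    by rewrite lerDr ltW.
  have xL1 : 1 <= `|x| / L by rewrite ler_pdivlMr// mul1r ltW.
  have -> : C / L ^+ (2 * N) * x ^+ (2 * N) = C * (`|x| / L) ^+ (2 * N).
    by rewrite -(LE x) expr_div_n; ring.
  apply: le_trans (ler_normB _ _) _; rewrite /C mulrDl lerD//.
    apply: le_trans (fM x) _; rewrite ler_peMr//; exact: exprn_ege1.
  rewrite horner_coef mulr_suml; apply: le_trans (ler_norm_sum _ _ _) _.
  apply: ler_sum => i _; rewrite normrM normrX -mulrA ler_wpM2l//.
  have -> : `|x| ^+ i = L ^+ i * (`|x| / L) ^+ i.
    by rewrite -exprMn mulrC divfK// gt_eqF.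
  rewrite ler_wpM2l ?exprn_ge0 ?(ltW L0)//; apply: ler_weXn2l => //.
  by apply: leq_trans pN; apply: ltnW.
have ifp (P : {measure set (measurableTypeR R) -> \bar R}) :
    P setT = 1%E -> (forall r : nat, P.-integrable setT (fun t => (t ^+ r)%:E)) ->
    `|Rintegral P setT f - Rintegral P setT (fun t => p.[t])| <=
    e / 5 + C / L ^+ (2 * N) * Rintegral P setT (fun t => t ^+ (2 * N)).
  move=> P1 Pi; have If := integrable_bounded_continuous P1 cf bf.
  have Ip := integrable_horner Pi p.
  rewrite -RintegralB//; apply: le_Rintegral_even_power => //.
  exact: integrableB If Ip.
have pcvg : Rintegral (mu m) setT (fun t => p.[t]) @[m --> \oo] -->
    Rintegral nu setT (fun t => p.[t]).
  rewrite Rintegral_horner//; under eq_fun do rewrite Rintegral_horner//.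
  apply: cvg_sum_seq => i _; apply: cvgM; [exact: cvg_cst|exact: mucvg].
have KN : 0 < K ^+ (2 * N) by exact: exprn_gt0.
have CK : C / L ^+ (2 * N) * K ^+ (2 * N) <= e / 10.
  apply: le_trans CN; rewrite /L exprMn.
  by rewrite le_eqVlt; apply/orP; left; apply/eqP; rewrite exprVn; field; rewrite !expf_neq0 ?gt_eqF.
move/cvgrPdist_le : pcvg => /(_ _ e5) pcvg.
move/cvgrPdist_le : (mucvg (2 * N)%N) => /(_ _ KN) mNcvg.
near=> m.
have h1 := ifp _ nu1 nui.
have h2 := ifp _ (mu1 m) (mui m).
have h3 : `|Rintegral nu setT (fun t => p.[t]) - Rintegral (mu m) setT (fun t => p.[t])| <= e / 5.
  by near: m.
have h4 : `|Rintegral nu setT (fun t => t ^+ (2 * N)) -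
     Rintegral (mu m) setT (fun t => t ^+ (2 * N))| <= K ^+ (2 * N) by near: m.
have CL0 : 0 <= C / L ^+ (2 * N) by rewrite divr_ge0// exprn_ge0// ltW.
have g1 : C / L ^+ (2 * N) * Rintegral nu setT (fun t => t ^+ (2 * N)) <= e / 10.
  by apply: le_trans CK; rewrite ler_wpM2l.
have g2 : C / L ^+ (2 * N) * Rintegral (mu m) setT (fun t => t ^+ (2 * N)) <= e / 10 + e / 10.
  apply: (@le_trans _ _ (C / L ^+ (2 * N) * (K ^+ (2 * N) + K ^+ (2 * N)))).
    rewrite ler_wpM2l//; have := nuK N; move: h4; rewrite ler_norml => /andP[]; lra.
  by rewrite mulrDr lerD.
move: h1 h2 h3 g1 g2; rewrite !ler_norml => /andP[? ?] /andP[? ?] /andP[? ?] ? ?.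
apply/andP; split; lra.
Unshelve. all: by end_near. Qed.

(** * Integrals against the semicircle laws *)

Section density.
Import HBNNSimple.
Local Open Scope ereal_scope.
Context d (T : measurableType d) (R : realType).
Variables (mu nu : {measure set T -> \bar R}) (g : T -> R).
Hypothesis mg : measurable_fun setT g.
Hypothesis g_ge0 : forall x, (0 <= g x)%R.
Hypothesis nuE : forall V, measurable V -> nu V = \int[mu]_(x in V) (g x)%:E.

(** A measure with density [g]: by monotone convergence from simple functions. *)
Lemma ge0_integral_density (f : T -> \bar R) :
  (forall x, 0 <= f x) -> measurable_fun setT f ->
  \int[nu]_x f x = \int[mu]_x (f x * (g x)%:E).
Proof.
move=> f0 mf; have mE : measurable [set: T] by [].
pose h := nnsfun_approx mE mf.
have mgE : measurable_fun setT (EFin \o g) by exact/measurable_EFinP.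
have -> : \int[nu]_x f x = lim (\int[nu]_x (EFin \o h n) x @[n --> \oo]).
  have fE x : f x = lim ((EFin \o h n) x @[n --> \oo]).
    by apply/esym/cvg_lim => //; exact: cvg_nnsfun_approx.
  under eq_integral do rewrite fE.
  apply: monotone_convergence => //.
  - by move=> n; apply/measurable_EFinP.
  - by move=> n x _ //=; rewrite lee_fin.
  - by move=> x _ a b ab; rewrite lee_fin; exact/lefP/nd_nnsfun_approx.
have -> : \int[mu]_x (f x * (g x)%:E) =
    lim (\int[mu]_x ((EFin \o h n) \* (EFin \o g)) x @[n --> \oo]).
  have fg x : f x * (g x)%:E = lim (((EFin \o h n) \* (EFin \o g)) x @[n --> \oo]).
    by apply/esym/cvg_lim => //; apply: cvgeZr => //; exact: cvg_nnsfun_approx.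
  under eq_integral do rewrite fg.
  apply: monotone_convergence => [//| | |].
  - by move=> n; apply/emeasurable_funM => //; exact/measurable_EFinP.
  - by move=> n x _ /=; rewrite mule_ge0 ?lee_fin.
  - by move=> x _ a b ab/=; rewrite lee_wpmul2r ?lee_fin//; exact/lefP/nd_nnsfun_approx.
suff suf n : \int[nu]_x (EFin \o h n) x = \int[mu]_x ((EFin \o h n) x * (g x)%:E).
  by under eq_fun do rewrite suf.
transitivity (\int[nu]_x
   (\sum_(y \in range (h n)) (y * \1_(h n @^-1` [set y]) x)%:E)).
  by apply: eq_integral => t tE; rewrite /= fimfunE -fsumEFin.
have indich m r : measurable_fun setT (fun x => (r * \1_(h m @^-1` [set r]) x)%:E).
  by apply: (measurable_comp measurableT) => //; exact: measurable_funM.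
rewrite ge0_integral_fsum//; last by move=> m y Ey; exact: nnfun_muleindic_ge0.
transitivity (\int[mu]_x (\sum_(y \in range (h n))
    (y * \1_(h n @^-1` [set y]) x)%:E * (g x)%:E)); last first.
  apply: eq_integral => x _.
  rewrite -ge0_mule_fsuml => [|y]; last exact: nnfun_muleindic_ge0.
  by rewrite fsumEFin // -(fimfunE _ x).
rewrite ge0_integral_fsum//; last 2 first.
  - by move=> y; apply: emeasurable_funM.
  - by move=> m y Ey; apply: mule_ge0; [exact: nnfun_muleindic_ge0|rewrite lee_fin].
apply: eq_fsbigr => r rhn.
under [LHS]eq_integral do rewrite EFinM.
rewrite integralZl_indic_nnsfun => //.
under [RHS]eq_integral do rewrite EFinM -muleA.
rewrite ge0_integralZl//.
- under [in RHS]eq_integral do rewrite muleC.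
  rewrite [in RHS](eq_integral ((EFin \o g) \_ (h n @^-1` [set r]))); last first.
    by move=> x xE; rewrite epatch_indic.
  by rewrite -integral_mkcondr integral_indic//= setIC nuE// setTI.
- by apply: emeasurable_funM => //; exact/measurable_EFinP.
- by move=> t Et; rewrite mule_ge0 ?lee_fin.
- by move: rhn; rewrite inE => -[t _ <-]; rewrite lee_fin.
Qed.

Lemma integral_density (f : T -> \bar R) : measurable_fun setT f ->
  \int[nu]_x f x = \int[mu]_x (f x * (g x)%:E).
Proof.
move=> mf; rewrite [in LHS]integralE [in RHS]integralE.
rewrite !ge0_integral_density//; try exact: measurable_funepos; try exact: measurable_funeneg.
congr (_ - _); apply: eq_integral => x _.
  rewrite !funeposE; have [fx|fx] := leP (f x) 0.
    by rewrite mul0e max_r// mule_le0_ge0// lee_fin.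
  by rewrite max_l// mule_ge0 ?lee_fin// ltW.
rewrite !funenegE; have [fx|fx] := leP (- f x) 0.
  by rewrite mul0e max_r// -mulNe mule_le0_ge0// lee_fin.
by rewrite max_l -mulNe// mule_ge0 ?lee_fin// ltW.
Qed.

End density.

Section semicircle_integrals.
Variable R : realType.
Implicit Types (t : R) (f : R -> R).
Local Notation lambda := (@lebesgue_measure R).

Lemma integral_semicircleE t f : 0 < t -> continuous f ->
  (\int[semicircle t]_x (f x)%:E = \int[lambda]_(x in `[(- (2 * Num.sqrt t))%R, (2 * Num.sqrt t)%R])
     (f x * ((2 * pi * t)^-1 * Num.sqrt (4 * t - x ^+ 2)))%:E)%E.
Proof.
move=> t0 cf.
rewrite (@integral_density _ _ _ lambda (semicircle t) (semicircle_pdf t)) //=.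
- rewrite [RHS]integral_mkcond; apply: eq_integral => x _.
  rewrite -EFinM patchE /semicircle_pdf mem_setE in_itv/= ler_norml.
  by case: ifP => // _; rewrite mulr0.
- exact: measurable_semicircle_pdf.
- exact: semicircle_pdf_ge0.
- by move=> V mV; rewrite /semicircle gt_eqF.
- by apply/measurable_EFinP; exact: continuous_measurable_fun.
Qed.

Lemma continuous_pdf_on t : continuous (fun x : R => (2 * pi * t)^-1 * Num.sqrt (4 * t - x ^+ 2)).
Proof.
move=> x; apply: cvgM; first exact: cvg_cst.
apply: (@continuous_comp _ _ _ (fun x : R => 4 * t - x ^+ 2) (@Num.sqrt R)); last exact: sqrt_continuous.
by apply: cvgB; [exact: cvg_cst|exact: exprn_continuous].
Qed.

(** [S(0,t)] is the image of [S(0,1)] under the dilation by [sqrt t]. *)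
Lemma integral_semicircle_scale t f : 0 < t -> continuous f ->
  (\int[semicircle t]_x (f x)%:E = \int[semicircle 1]_x (f (Num.sqrt t * x))%:E)%E.
Proof.
move=> t0 cf; pose s : R := Num.sqrt t; have s0 : 0 < s by rewrite sqrtr_gt0.
have s2 : s ^+ 2 = t by rewrite sqr_sqrtr// ltW.
have cfs : continuous (fun x => f (s * x)).
  move=> x; apply: (@continuous_comp _ _ _ (fun x => s * x) f); last exact: cf.
  exact: mulrl_continuous.
rewrite !integral_semicircleE// -/s sqrtr1 !mulr1.
pose F (x : R) : R := s * x.
have DF : derive1 (F : R -> R) = cst s.
  apply/funext => x; rewrite derive1E /F.
  have : is_derive x 1 (fun x => s * x) s.
    by apply: is_derive_eq; rewrite -[_%:A]/(s * 1) mulr1.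
  by move=> /@derive_val.
have -> : (- (2 * s) = F (- 2))%R by rewrite /F; ring.
have -> : (2 * s = F 2)%R by rewrite /F; ring.
rewrite (@integration_by_substitution_increasing _ F (fun x => f x * ((2 * pi * t)^-1 * Num.sqrt (4 * t - x ^+ 2))) (-2) 2).
- apply: eq_integral => x _; congr EFin; rewrite DF /F.
  transitivity (f (s * x) * ((2 * pi * t)^-1 * Num.sqrt (4 * t - (s * x) ^+ 2)) * s); first by [].
  have -> : 4 * t - (s * x) ^+ 2 = t * (4 - x ^+ 2) by rewrite exprMn s2; ring.
  rewrite sqrtrM ?ltW// -/s -s2.
  have aux (y z p q : R) : q != 0 -> p != 0 ->
      y * ((2 * p * q ^+ 2)^-1 * (q * z)) * q = y * ((2 * p)^-1 * z).
    by move=> q0 p0; field; rewrite q0 p0.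
  by apply: aux; rewrite gt_eqF ?pi_gt0.
- by lra.
- by move=> x y _ _ xy; rewrite /F ltr_pM2l.
- by move=> x _; rewrite DF; exact: cvg_cst.
- by rewrite DF; exact: is_cvg_cst.
- by rewrite DF; exact: is_cvg_cst.
- split.
  + by move=> x _; rewrite /F; exact: derivableM.
  + by apply: cvg_at_right_filter; exact: mulrl_continuous.
  + by apply: cvg_at_left_filter; exact: mulrl_continuous.
- apply: continuous_subspaceT => x; apply: cvgM; first exact: cf.
  exact: continuous_pdf_on.
Qed.

(** The function [x (4 - x ^ 2) ^ (3 / 2)] vanishes at the end points and its
    derivative is [4 (1 - x ^ 2) (4 - x ^ 2) ^ (1 / 2)], hence the second moment
    equals the total mass. *)
Lemma second_moment_semicircle1 : (semicircle 1%R [set: measurableTypeR R] = 1)%E ->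
  Rintegral (semicircle (1 : R)) setT (fun x => x ^+ 2) = 1.
Proof.
move=> mass1.
pose w (x : R) : R := Num.sqrt (4 - x ^+ 2).
pose k : R := (2 * pi)^-1.
pose F (x : R) := k / 4 * (x * (4 - x ^+ 2) * w x).
have cw : continuous w.
  move=> x; apply: (@continuous_comp _ _ _ (fun x : R => 4 - x ^+ 2) (@Num.sqrt R)); last exact: sqrt_continuous.
  by apply: cvgB; [exact: cvg_cst|exact: exprn_continuous].
have c2 : continuous (fun x : R => 4 - x ^+ 2).
  by move=> x; apply: cvgB; [exact: cvg_cst|exact: exprn_continuous].
have cF : continuous F.
  move=> x; apply: cvgM; first exact: cvg_cst.
  by apply: cvgM; [apply: cvgM; [exact: cvg_id|exact: c2]|exact: cw].
have cg1 : continuous (fun x : R => 1 * (k * w x)).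
  by move=> x; apply: cvgM; [exact: cvg_cst|apply: cvgM; [exact: cvg_cst|exact: cw]].
have cg2 : continuous (fun x : R => x ^+ 2 * (k * w x)).
  by move=> x; apply: cvgM; [exact: exprn_continuous|apply: cvgM; [exact: cvg_cst|exact: cw]].
have ib (g : R -> R) : continuous g -> lambda.-integrable `[(-2)%R, 2%R] (EFin \o g).
  move=> cg; apply: continuous_compact_integrable; first exact: segment_compact.
  exact: continuous_subspaceT.
have DF (x : R) : x \in `](-2)%R, 2%R[ -> is_derive x 1 F (1 * (k * w x) - x ^+ 2 * (k * w x)).
  rewrite in_itv/= => /andP[x1 x2].
  have w0 : 0 < 4 - x ^+ 2 by nra.
  have dq : is_derive x 1 (fun x : R => 4 - x ^+ 2) (- (2 * x)).
    by apply: is_derive_eq; rewrite -[x%:A]/(x * 1); ring.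
  have dw : is_derive x 1 w ((2 * w x)^-1 * (- (2 * x))).
    have ds : is_derive (4 - x ^+ 2) 1 (@Num.sqrt R) (2 * w x)^-1 := is_derive1_sqrt w0.
    exact: (@is_derive1_comp _ (@Num.sqrt R) (fun x : R => 4 - x ^+ 2) x _ _ ds dq).
  apply: is_derive_eq; rewrite /GRing.scale /=.
  have w2 : w x ^+ 2 = 4 - x ^+ 2 by rewrite sqr_sqrtr// ltW.
  have wx : w x != 0 by rewrite gt_eqF// sqrtr_gt0.
  have e : (4 - x ^+ 2) * (2 * w x)^-1 = w x / 2 by rewrite -w2; field.
  have aux (K y i a : R) : (4 - y ^+ 2) * i = a / 2 ->
      K / 4 * (y * (4 - y ^+ 2) * (i * - (2 * y)) + a * (y * - (2 * y) + (4 - y ^+ 2) * 1))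
      = 1 * (K * a) - y ^+ 2 * (K * a).
    move=> ea; rewrite (_ : y * _ * _ = (4 - y ^+ 2) * i * (- (2 * y ^+ 2))); last by ring.
    by rewrite ea; field.
  exact: aux.
have FTC : (\int[lambda]_(x in `[(-2)%R, 2%R]) (1 * (k * w x) - x ^+ 2 * (k * w x))%:E = 0)%E.
  rewrite (@continuous_FTC2 _ _ F) ?ltrN2//.
  - rewrite /F sqrrN (_ : 4 - 2 ^+ 2 = 0 :> R); last by ring.
    by rewrite !mulr0 !mul0r !mulr0 subee.
  - by lra.
  - by apply: continuous_subspaceT => x; apply: cvgB; [exact: cg1|exact: cg2].
  - split; first by move=> x /DF[].
      by apply: cvg_at_right_filter; exact: cF.
    by apply: cvg_at_left_filter; exact: cF.
  - by move=> x /DF dF; rewrite derive1E; exact: derive_val.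
have c1 : continuous (fun _ : R => 1 : R) by move=> x; exact: cvg_cst.
have mass : (\int[lambda]_(x in `[(-2)%R, 2%R]) (1 * (k * w x))%:E = 1)%E.
  transitivity (\int[semicircle (1 : R)]_x (1%R)%:E)%E; last first.
    by rewrite integral_cst// mul1e; exact: mass1.
  have := integral_semicircleE ltr01 c1; rewrite sqrtr1 !mulr1 => ->.
  by apply: eq_integral => x _; rewrite /k /w ?mulr1.
rewrite /Rintegral (integral_semicircleE ltr01); last exact: exprn_continuous.
rewrite sqrtr1 !mulr1.
move: FTC; rewrite (integralB_EFin _ (ib _ cg1) (ib _ cg2)) ?mass//.
rewrite -/k => h; have fin := integrable_fin_num _ (ib _ cg2).
move: h; rewrite -[X in (_ - X)%E]fineK ?fin// -EFinB => -[/eqP].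
by rewrite subr_eq0 => /eqP<-.
Qed.

End semicircle_integrals.

(** * Self-adjointness *)

Section self_adjoint.
Variables (R : realType) (A : wstar_prob_space R).
Implicit Types a b : A.

(** Self-adjointness, expressed on the Hilbert space. It is equivalent to
    [self_adjoint a] and does not need any property of [star]. *)
Definition symmetric_operator a :=
  forall x y, inner A (wrep a x) y = inner A x (wrep a y).

Lemma symmetric_self_adjoint a : symmetric_operator a -> self_adjoint a.
Proof.
move=> sa; apply: (@wrep_inj R A); apply/funext => y; apply/eqP.
have h x : inner A x (wrep (star a) y) = inner A x (wrep a y) by rewrite -wrep_star sa.
rewrite -subr_eq0 -normr_eq0 -sqrf_eq0 -inner_norm.
rewrite linearBr subr_eq0; apply/eqP; exact: h.
Qed.

Lemma self_adjoint_symmetric a : self_adjoint a -> symmetric_operator a.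
Proof. by move=> sa x y; rewrite wrep_star sa. Qed.

Let wrep0 x : wrep (0 : A) x = 0.
Proof.
have := @wrepP R A (-1) 0 0 x; rewrite scaler0 add0r scaleN1r => ->.
by rewrite addrC subrr.
Qed.

Lemma symmetric_operatorP (r : R) a b : symmetric_operator a ->
  symmetric_operator b -> symmetric_operator (r%:C *: a + b).
Proof.
move=> sa sb x y; rewrite !wrepP linearPl linearPr /= sa sb.
by congr (_ * _ + _); exact: (esym (conjc_real r)).
Qed.

Lemma symmetric_operator0 : symmetric_operator (0 : A).
Proof. by move=> x y; rewrite !wrep0 linear0l linear0r. Qed.

Lemma symmetric_operatorD a b : symmetric_operator a ->
  symmetric_operator b -> symmetric_operator (a + b).
Proof. by move=> sa sb; have := symmetric_operatorP 1 sa sb; rewrite scale1r. Qed.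

Lemma symmetric_operatorZ (r : R) a : symmetric_operator a ->
  symmetric_operator (r%:C *: a).
Proof.
by move=> sa; have := symmetric_operatorP r sa symmetric_operator0; rewrite addr0.
Qed.

Lemma symmetric_operator1 : symmetric_operator (1 : A).
Proof. by move=> x y; rewrite !wrep1. Qed.

Lemma symmetric_operatorM a b : symmetric_operator a -> symmetric_operator b ->
  a * b = b * a -> symmetric_operator (a * b).
Proof. by move=> sa sb ab x y; rewrite wrepM sa sb -wrepM ab. Qed.

Lemma symmetric_real_horner (p : {poly R}) a :
  symmetric_operator a -> symmetric_operator (real_horner p a).
Proof.
move=> sa; elim/poly_ind: p => [|p c IH].
  by rewrite /real_horner !rmorph0; exact: symmetric_operator0.
have -> : real_horner (p * 'X + c%:P) a = real_horner p a * a + c%:C *: 1.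
  by rewrite /real_horner rmorphD rmorphM /= map_polyX map_polyC !rmorphD !rmorphM /= horner_algX horner_algC.
apply: symmetric_operatorD; last exact/symmetric_operatorZ/symmetric_operator1.
apply: symmetric_operatorM => //.
rewrite /real_horner; set q := map_poly _ _.
have h1 : horner_alg a (q * 'X) = horner_alg a q * a by rewrite rmorphM /= horner_algX.
have h2 : horner_alg a ('X * q) = a * horner_alg a q by rewrite rmorphM /= horner_algX.
by rewrite -h1 -h2 mulrC.
Qed.

Lemma symmetric_operator_sum (m : nat) (F : 'I_m -> A) :
  (forall k, symmetric_operator (F k)) -> symmetric_operator (\sum_(k < m) F k).
Proof.
move=> sF; elim/big_ind: _ => // [|a b]; first exact: symmetric_operator0.
exact: symmetric_operatorD.
Qed.

Lemma phi_sqr_ge0 a : self_adjoint a -> 0 <= phi (a ^+ 2).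
Proof. by move=> sa; rewrite expr2 -{1}sa; exact: phi_pos. Qed.

End self_adjoint.

(** * Moments of the semicircle laws *)

Section semicircle_moments.
Variable R : realType.

Lemma arc_moment_scale (s : R) a r :
  arc_moment (s ^+ 2) a r = s ^+ (a + r) * arc_moment 1 a r.
Proof.
elim: r a => [|r IH] [|a] /=.
- by rewrite mulr1.
- by rewrite mulr0.
- by rewrite !addr0 IH add1n add0n.
- by rewrite !IH !addSn !addnS !exprS; ring.
Qed.

Lemma arc_moment_le a r : arc_moment (1 : R) a r <= 2 ^+ r.
Proof.
elim: r a => [|r IH] a /=; first by case: a => [|a] //=; exact: ler01.
have h := IH a.+1; case: a h => [|a] h; rewrite exprS mulr_natl mulr2n; last first.
  by rewrite mul1r lerD.
by rewrite addr0 (le_trans h)// lerDl exprn_ge0.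
Qed.

(** For [n = m = 1] the only letter is [0], and all the covariances are [1]. *)
Lemma wick_moment_arc (c : nat -> nat -> R) a r : c 0%N 0%N = 1 ->
  wick_moment c 1 1 r (nseq a 0%N) = arc_moment 1 a r.
Proof.
move=> c1; elim: r a => [|r IH] a /=; first by rewrite /nilp size_nseq.
rewrite big_ord_recl big_ord0 addr0 big_mkcond big_nat_recl//= big_nat1.
rewrite size_nseq take0 big_nil mul1r drop0; congr (_ + _).
  exact: (IH a.+1).
by case: a => [//|a]; rewrite /= take0 drop0 big_seq1 c1 -IH.
Qed.

Hypothesis mass1 : (semicircle 1%R [set: measurableTypeR R] = 1)%E.
Hypothesis pow1 : forall r : nat, (semicircle (1 : R)).-integrable setT (fun t => (t ^+ r)%:E).
Hypothesis mom1 : forall r : nat,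
  Rintegral (semicircle (1 : R)) setT (fun t => t ^+ r) = arc_moment 1 0 r.

Let semicircle0E (V : set (measurableTypeR R)) : semicircle 0%R V = \d_(0 : measurableTypeR R) V.
Proof. by rewrite /semicircle eqxx. Qed.

Let mom0 r : (\int[semicircle (0 : R)]_x (x ^+ r)%:E = (0 ^+ r)%:E)%E.
Proof.
rewrite (eq_measure_integral (\d_(0 : measurableTypeR R))); last first.
  by move=> V mV _; exact: semicircle0E.
rewrite integral_dirac//; last first.
  by apply/measurable_EFinP; exact: (continuous_measurable_fun (@exprn_continuous _ r)).
by rewrite [X in (X * _)%E](_ : _ = 1%E) ?mul1e//; exact: diracT.
Qed.

Let momt (t : R) r : 0 < t -> (\int[semicircle t]_x (x ^+ r)%:E =
  (Num.sqrt t ^+ r)%:E * \int[semicircle (1 : R)]_x (x ^+ r)%:E)%E.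
Proof.
move=> t0; rewrite integral_semicircle_scale//; last exact: exprn_continuous.
rewrite -integralZl//; apply: eq_integral => x _.
by rewrite exprMn EFinM.
Qed.

Lemma semicircle_mass (t : R) : 0 <= t -> (semicircle t [set: measurableTypeR R] = 1)%E.
Proof.
rewrite le_eqVlt => /predU1P[<-|t0]; first by rewrite semicircle0E diracT.
have := momt 0 t0; rewrite expr0 mul1e.
under eq_integral do rewrite expr0; rewrite integral_cst// mul1e.
under eq_integral do rewrite expr0; rewrite integral_cst// mul1e.
by move=> h; rewrite -mass1; exact: h.
Qed.

Lemma semicircle_moment (t : R) r : 0 <= t ->
  Rintegral (semicircle t) setT (fun x => x ^+ r) = arc_moment t 0 r.
Proof.
rewrite le_eqVlt => /predU1P[<-|t0].
  have := arc_moment_scale (0 : R) 0 r; rewrite expr0n add0n => ->.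
  rewrite /Rintegral mom0 /=.
  by case: r => [|r]; rewrite ?mulr1// !expr0n !mul0r.
rewrite /Rintegral momt//.
have e2 : t = Num.sqrt t ^+ 2 by rewrite sqr_sqrtr// ltW.
rewrite [in RHS]e2 arc_moment_scale add0n -mom1 fineM//.
exact: integrable_fin_num (pow1 r).
Qed.

Lemma semicircle_integrable (t : R) r : 0 <= t ->
  (semicircle t).-integrable setT (fun x => (x ^+ r)%:E).
Proof.
move=> t0; apply/integrableP; split.
  by apply/measurable_EFinP; exact: (continuous_measurable_fun (@exprn_continuous _ r)).
move: t0; rewrite le_eqVlt => /predU1P[<-|t0].
  rewrite (eq_measure_integral (\d_(0 : measurableTypeR R))); last first.
    by move=> V mV _; exact: semicircle0E.
  rewrite integral_dirac//; last first.
    by apply: measurableT_comp => //; apply/measurable_EFinP; exact: (continuous_measurable_fun (@exprn_continuous _ r)).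
  by rewrite [X in (X * _)%E](_ : _ = 1%E) ?mul1e ?ltry//; exact: diracT.
have cn : continuous (fun x : R => `|x ^+ r|).
  by move=> x; apply: cvg_norm; exact: exprn_continuous.
have := integral_semicircle_scale t0 cn => /= ->.
under eq_integral do rewrite exprMn normrM EFinM.
rewrite ge0_integralZl//.
- by rewrite lte_mul_pinfty//; have /integrableP[_] := pow1 r.
- by apply/measurable_EFinP; exact: continuous_measurable_fun.
Qed.

End semicircle_moments.

(** * The central limit theorem *)

Lemma esum_int_ge_sum_nat (R : realType) (g : int -> R) (N : nat) :
  (forall k, 0 <= g k) ->
  ((\sum_(0 <= l < N) g (Posz l))%:E <= \esum_(k in [set: int]) (g k)%:E)%E.
Proof.
move=> g0; have fin : finite_set (Posz @` `I_N) by exact/finite_image/finite_II.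
apply: esum_ge; exists (Posz @` `I_N) => //.
rewrite -esum_fset//; last by move=> i _; rewrite lee_fin.
rewrite esum_image; last by move=> i j _ _ [].
rewrite esum_fset//; last by move=> i _; rewrite lee_fin.
by rewrite -fsbig_ord -sumEFin big_mkord.
Qed.

(** The law of [X 0] is [S(0,1)], and the moments of [X 0] are known. *)
Lemma semicircle1_moment (R : realType) (A : wstar_prob_space R) (X : nat -> A)
    (c : nat -> nat -> R) (r : nat) : semicircular_family X ->
  (forall j k, phi (X j * X k) = (c j k)%:C) -> (forall k, c k k = 1) ->
  is_law (X 0%N) (semicircle 1) ->
  Rintegral (semicircle (1 : R)) setT (fun t => t ^+ r) = arc_moment 1 0 r.
Proof.
move=> Xsc Xc c1 [_ _ /(_ r) [_ mom]]; apply: (@complexI R).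
rewrite -mom -(wick_moment_arc 0 r (c1 0%N)).
rewrite -(phi_wick_mul_chebyshev_sum Xc Xsc c1 1 1 r [::]) mul1r big_ord_recl big_ord0 addr0.
by rewrite real_horner_cheb1.
Qed.

Theorem corollary2p3 (R : realType) (A : wstar_prob_space R) (X : int -> A)
    (rho : int -> R) (n : nat) (U : {poly R})
    (X_semicircular : semicircular_family X)
    (X_law : forall k, is_law (X k) (semicircle 1))
    (X_cov : forall j k, phi (X j * X k) = (rho (k - j))%:C)
    (n_ge1 : (1 <= n)%N)
    (rho_summable : (\esum_(k in [set: int]) (`|rho k| ^+ n)%:E < +oo)%E)
    (U_cheb : is_chebyshevU n U) :
  let sigma2 := bilateral_sum (fun k => rho k ^+ n) in
  let V := fun m : nat =>
    ((Num.sqrt m%:R)^-1)%:C *: \sum_(k < m) real_horner U (X (Posz k)) in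
  0 <= sigma2 /\ cvg_in_law V (semicircle sigma2).
Proof.
move=> sigma2 V.
(* the trace property makes the covariance function even *)
have rhoN k : rho (- k) = rho k.
  have := phi_trace (X 0) (X k); rewrite !X_cov subr0 sub0r => /complexI.
  by move=> ->.
pose f (l : nat) : R := rho (Posz l).
pose c (j k : nat) : R := f (j - k + (k - j))%N.
pose Y (k : nat) : A := X (Posz k).
have Y_cov j k : phi (Y j * Y k) = (c j k)%:C.
  rewrite X_cov /c /f; congr (_ %:C).
  have [jk|/ltnW kj] := leqP j k.
    by congr rho; lia.
  by rewrite -rhoN; congr rho; lia.
have Y_sc : semicircular_family Y.
  have [h1 h2 h3] := X_semicircular; split=> [i|i j|r k]; [exact: h1|exact: h2|].
  exact: (h3 r (fun i => Posz (k i))).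
have [_ mass1 pow1'] := X_law 0.
have pow1 r := proj1 (pow1' r).
have c1 k : c k k = 1.
  rewrite /c subnn; have [_ m2] := pow1' 2%N.
  by apply: (@complexI R); rewrite -[LHS]/((rho (0 - 0))%:C) -X_cov -expr2 m2 second_moment_semicircle1.
have mom1 r := semicircle1_moment r Y_sc Y_cov c1 (X_law 0).
have UE : U = chebyshevU R n := is_chebyshevU_uniq U_cheb (@is_chebyshevU_chebyshevU R n).
have phiV m r : phi (V m ^+ r) =
    ((Num.sqrt m%:R)^-1 ^+ r * wick_moment c m n r [::])%:C.
  rewrite /V exprZn UE.
  have phiZ (t : R[i]) (a : A) : phi (t *: a) = t * phi a.
    have phi0 : phi (0 : A) = 0.
      apply: (addIr (phi (0 : A))); have := @phi_linear R A 1 0 0.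
      by rewrite scale1r mul1r addr0 add0r.
    by have := @phi_linear R A t a 0; rewrite !addr0 phi0 addr0.
  rewrite phiZ rmorphM rmorphXn /=; congr (_ * _).
  by rewrite -(phi_wick_mul_chebyshev_sum Y_cov Y_sc c1) mul1r.
pose C := fine (\esum_(k in [set: int]) (`|rho k| ^+ n)%:E)%E.
have f_summable N : \sum_(0 <= l < N) `|f l| ^+ n <= C.
  rewrite -lee_fin /C fineK.
    by apply: (@esum_int_ge_sum_nat R (fun k => `|rho k| ^+ n)) => k; exact: exprn_ge0.
  by rewrite ge0_fin_numE// esum_ge0// => k _; rewrite lee_fin exprn_ge0.
have sigma2E : sigma2 = limn (series (fun k => f k ^+ n)) +
    limn (series (fun k => f k.+1 ^+ n)).
  rewrite /sigma2 /bilateral_sum; congr (_ + limn (series _)).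
  by apply/funext => k; rewrite NegzE rhoN.
have cvgV r : (Num.sqrt m%:R)^-1 ^+ r * wick_moment c m n r [::] @[m --> \oo] -->
    arc_moment sigma2 0 r.
  by rewrite sigma2E; exact: (stationary_moment_cvg n_ge1 f_summable).
have sigma2_ge0 : 0 <= sigma2.
  have -> : sigma2 = arc_moment sigma2 0 2 by rewrite /= mulr1 !addr0 add0r.
  have /cvg_lim <- // := cvgV 2%N; apply: limr_ge; first exact: cvgP (cvgV 2%N).
  near=> m; rewrite -lecR -phiV; apply/phi_sqr_ge0/symmetric_self_adjoint.
  apply/symmetric_operatorZ/symmetric_operator_sum => k.
  by apply/symmetric_real_horner/self_adjoint_symmetric; have [] := X_law (Posz k).
split=> // mu mu_law.
have muE m r : Rintegral (mu m) setT (fun t => t ^+ r) =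
    (Num.sqrt m%:R)^-1 ^+ r * wick_moment c m n r [::].
  by have [_ _ /(_ r) [_]] := mu_law m; rewrite phiV => /complexI.
have momt r := semicircle_moment pow1 mom1 r sigma2_ge0.
pose K := 2 * Num.sqrt sigma2 + 1.
have s0 : 0 <= Num.sqrt sigma2 by exact: sqrtr_ge0.
apply: (@moments_weak_cvg R mu (semicircle sigma2) K).
- by rewrite /K; lra.
- exact: semicircle_mass.
- by move=> m; have [] := mu_law m.
- by move=> r; exact: semicircle_integrable.
- by move=> m r; have [_ _ /(_ r) []] := mu_law m.
- move=> N; rewrite momt -[in leLHS](sqr_sqrtr sigma2_ge0) arc_moment_scale add0n.
  apply: (@le_trans _ _ ((2 * Num.sqrt sigma2) ^+ (2 * N))).
    by rewrite exprMn mulrC ler_wpM2r ?exprn_ge0// arc_moment_le.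
  by rewrite lerXn2r// ?nnegrE /K; lra.
- by move=> r; rewrite momt; under eq_fun do rewrite muE; exact: cvgV.
Unshelve. all: by end_near. Qed.
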